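(* Let $m,n$ be positive integers and let $u_1,\dots,u_m$, $x_1,\dots,x_n$ be complex numbers with $su_i\ne1$ for all $i$. Then $$ \sum_{\lambda} \widetilde{\mathsf F}_{\lambda}(u_1,\dots,u_m)\, \mathbb{F}^{*}_{\lambda'}(x_1,\dots,x_n) = \sum_{\lambda} \widetilde{\mathsf F}^{*}_{\lambda}(u_1,\dots,u_m)\, \mathbb{F}_{\lambda'}(x_1,\dots,x_n) = \prod_{i=1}^{m}\prod_{j=1}^{n} \left(\frac{1+u_ix_j}{1-su_i}\right), $$ where the sums are over all (positive) partitions $\lambda$.
   Context: Fix $q,s\in\mathbb{C}$ with $|q|<1$, $|s|<1$. Write $(a;q)_m=\prod_{i=1}^m(1-aq^{i-1})$ for $m\ge 1$, $(a;q)_0=1$. A (positive) partition is a finite, possibly empty, sequence $\lambda_1\ge\dots\ge\lambda_\ell\ge1$ of integers, with $\lambda_i:=0$ for $i>\ell$; $m_i(\lambda)=\#\{j:\lambda_j=i\}$ for $i\ge1$; $\lambda'$ is the conjugate partition, so $m_i(\lambda')=\lambda_i-\lambda_{i+1}$. Put $\tilde c_{\lambda}=\prod_{i\ge1}\frac{(s^2;q)_{m_i(\lambda)}}{(q;q)_{m_i(\lambda)}}$. Spin $q$-Whittaker polynomials. For $x\in\mathbb{C}$ and $i,j,k,\ell\in\mathbb{Z}_{\ge0}$, $$W_x(i,j;k,\ell)=\mathbf 1_{i+j=k+\ell}\,\mathbf 1_{i\ge\ell}\;x^\ell\frac{(-s/x;q)_\ell\,(-sx;q)_{i-\ell}\,(q;q)_k}{(q;q)_\ell\,(q;q)_{i-\ell}\,(s^2;q)_k},$$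 where $x^\ell(-s/x;q)_\ell$ is read as $\prod_{r=0}^{\ell-1}(x+sq^r)$. For a partition $\lambda$, $$\mathbb{F}_{\lambda}(x_1,\dots,x_n)=\sum\prod_{r=1}^n\left[x_r^{h_{r,0}}\frac{(-s/x_r;q)_{h_{r,0}}}{(q;q)_{h_{r,0}}}\prod_{c\ge1}W_{x_r}\big(v_{r-1,c},h_{r,c-1};v_{r,c},h_{r,c}\big)\right],$$ the sum running over all non-negative integers $h_{r,c}$ ($1\le r\le n$, $c\ge0$), with $h_{r,c}=0$ for all large $c$, and $v_{r,c}$ ($0\le r\le n$, $c\ge1$) subject to $v_{0,c}=0$ and $v_{n,c}=\lambda_c-\lambda_{c+1}$ (all but finitely many weights equal $1$ in any nonzero term). The dual polynomial is $\mathbb{F}^*_{\lambda}=\tilde c_{\lambda'}\mathbb{F}_{\lambda}$. Stable spin Hall--Littlewood functions. For $i,k\in\mathbb{Z}_{\ge0}$ and $j,\ell\in\{0,1\}$ let $w_u(i,j;k,\ell)$ be zero unless $i+j=k+\ell$, and for $g\in\mathbb{Z}_{\ge0}$ $$w_u(g,0;g,0)=\tfrac{1-sq^gu}{1-su},\quad w_u(g+1,0;g,1)=\tfrac{(1-s^2q^g)u}{1-su},\quad w_u(g,1;g+1,0)=\tfrac{1-q^{g+1}}{1-su},\quad w_u(g,1;g,1)=\tfrac{u-sq^g}{1-su}.$$ For partitions $\lambda,\mu$ put $$\langle\!\langle\mu|\widetilde C(u)|\lambda\rangle\!\rangle=\sum_{h_0,h_1,\ldots}u^{h_0}\prod_{c\ge1}w_u\big(m_c(\mu),h_{c-1};m_c(\lambda),h_c\big),$$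 the sum over sequences $h_c\in\{0,1\}$ with $h_c=0$ for all large $c$. Then $\widetilde{\mathsf F}_{\lambda}(u_1,\dots,u_m)=\langle\!\langle\varnothing|\widetilde C(u_1)\cdots\widetilde C(u_m)|\lambda\rangle\!\rangle$, i.e. $\sum\prod_{r=1}^m\langle\!\langle\nu^{(r-1)}|\widetilde C(u_r)|\nu^{(r)}\rangle\!\rangle$ over chains of partitions $\nu^{(0)}=\varnothing,\nu^{(1)},\dots,\nu^{(m)}=\lambda$; and $\widetilde{\mathsf F}^*_\lambda=\tilde c_\lambda\widetilde{\mathsf F}_\lambda$. *)

(* Defs.v *)
(* The definitions are given over an arbitrary numFieldType; the complex numbers
   are its instance R[i] for R : realType. *)
From HB Require Import structures.
From mathcomp Require Import all_boot all_order all_algebra.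
From mathcomp Require Import boolp classical_sets functions cardinality fsbigop.
From mathcomp Require Import reals topology normedtype sequences.

Set Implicit Arguments.
Unset Strict Implicit.
Unset Printing Implicit Defensive.

Import Order.TTheory GRing.Theory Num.Theory.
Import numFieldNormedType.Exports.

Local Open Scope classical_set_scope.
Local Open Scope ring_scope.

Definition is_intpart (l : seq nat) : bool := sorted geq l && (0%N \notin l).

Record intpart := IntPart {
  parts :> seq nat;
  partsP : is_intpart parts }.

HB.instance Definition _ := [isSub for parts].
HB.instance Definition _ := [Countable of intpart by <:].

Definition empty_intpart : intpart := @IntPart [::] isT.

(* Parts are numbered from 0: [part la c] is $\lambda_{c+1}$. *)
Definition part (la : intpart) (c : nat) : nat := nth 0%N la c.

Definition mult (la : intpart) (i : nat) : nat := count_mem i la.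

Definition conj_seq (l : seq nat) : seq nat :=
  mkseq (fun i => count (fun a => i < a)%N l) (head 0%N l).

Lemma conj_seqP (la : intpart) : is_intpart (conj_seq la).
Proof.
case: la => l /= /andP[sl _]; apply/andP; split.
  rewrite /conj_seq /mkseq sorted_map.
  apply: (@sub_sorted _ leq); last exact: iota_sorted.
  move=> i j /= ij; apply: sub_count => a /=; exact: leq_ltn_trans.
apply/mapP => -[k]; rewrite mem_iota add0n /= => kl; move/esym/eqP.
rewrite -leqn0 leqNgt -has_count => /negP; apply.
by case: l kl {sl} => //= a l ->.
Qed.

Definition conj_part (la : intpart) : intpart := IntPart (conj_seqP la).

(* Infinite product over c = 0, 1, 2, ...  The finitely supported big operator
   would be wrong here: a product with infinitely many vanishing factors has to
   be 0, not 1. *)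
Definition iprod (C : numFieldType) (f : nat -> C) : C :=
  lim ((fun N : nat => \prod_(c < N) f c) @ \oo).

Definition qpoch (C : numFieldType) (q a : C) (m : nat) : C :=
  \prod_(i < m) (1 - a * q ^+ i).

Definition ctilde (C : numFieldType) (q s : C) (la : intpart) : C :=
  iprod (fun i => qpoch q (s ^+ 2) (mult la i.+1) / qpoch q q (mult la i.+1)).

(* $x^l (-s/x;q)_l$, which is a polynomial in x *)
Definition xpoch (C : numFieldType) (q s x : C) (l : nat) : C :=
  \prod_(r < l) (x + s * q ^+ r).

Definition weightW (C : numFieldType) (q s x : C) (i j k l : nat) : C :=
  if ((i + j == k + l) && (l <= i))%N then
    xpoch q s x l * qpoch q (- (s * x)) (i - l) * qpoch q q k
      / (qpoch q q l * qpoch q q (i - l) * qpoch q (s ^+ 2) k)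
  else 0.

(* Rows r = 1, ..., n are the elements of 'I_n, numbered from 0; [h r c] is
   $h_{r+1,c}$ and [v r c] is $v_{r,c+1}$, so that the vertical numbers below
   and above row r are [v (widen_ord _ r)] and [v (lift ord0 r)].
   For a given partition only finitely many configurations have a nonzero
   weight, so that the finitely supported sum in [sqW] is the full sum. *)
Definition sqW_config (n : nat) (la : intpart) :
    set (('I_n -> nat -> nat) * ('I_n.+1 -> nat -> nat)) :=
  [set hv | [/\ forall r, \forall c \near \oo, hv.1 r c = 0%N,
                forall c, hv.2 ord0 c = 0%N &
                forall c, hv.2 ord_max c = (part la c - part la c.+1)%N]].

Definition sqW_weight (C : numFieldType) (q s : C) (n : nat) (x : 'I_n -> C)
    (h : 'I_n -> nat -> nat) (v : 'I_n.+1 -> nat -> nat) : C :=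
  \prod_(r < n)
    (xpoch q s (x r) (h r 0%N) / qpoch q q (h r 0%N) *
     iprod (fun c => weightW q s (x r) (v (widen_ord (leqnSn n) r) c) (h r c)
                                       (v (lift ord0 r) c) (h r c.+1))).

Definition sqW (C : numFieldType) (q s : C) (n : nat) (x : 'I_n -> C)
    (la : intpart) : C :=
  \sum_(hv \in @sqW_config n la) sqW_weight q s x hv.1 hv.2.

Definition sqW_dual (C : numFieldType) (q s : C) (n : nat) (x : 'I_n -> C)
    (la : intpart) : C :=
  ctilde q s (conj_part la) * sqW q s x la.

(* Horizontal numbers are in {0, 1}, encoded as booleans. *)
Definition weightw (C : numFieldType) (q s u : C)
    (i : nat) (j : bool) (k : nat) (l : bool) : C :=
  if (i + j == k + l)%N then
    match j, l with
    | false, false => (1 - s * q ^+ i * u) / (1 - s * u)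
    | false, true => (1 - s ^+ 2 * q ^+ k) * u / (1 - s * u)
    | true, false => (1 - q ^+ i.+1) / (1 - s * u)
    | true, true => (u - s * q ^+ i) / (1 - s * u)
    end
  else 0.

(* [opC q s u mu la] is $\langle\langle\mu|\widetilde C(u)|\lambda
   \rangle\rangle$.  The factor of index c below is that of column c + 1.
   At most one sequence h has a nonzero weight. *)
Definition opC (C : numFieldType) (q s u : C) (mu la : intpart) : C :=
  \sum_(h \in [set h : nat -> bool | \forall c \near \oo, h c = false])
    (u ^+ h 0%N *
     iprod (fun c => weightw q s u (mult mu c.+1) (h c)
                                   (mult la c.+1) (h c.+1))).

(* Only finitely many chains ending at la have a nonzero weight. *)
Definition sHL (C : numFieldType) (q s : C) (m : nat) (u : 'I_m -> C)
    (la : intpart) : C :=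
  \sum_(nu \in [set nu : 'I_m.+1 -> intpart |
                 nu ord0 = empty_intpart /\ nu ord_max = la])
    \prod_(r < m) opC q s (u r) (nu (widen_ord (leqnSn m) r)) (nu (lift ord0 r)).

Definition sHL_dual (C : numFieldType) (q s : C) (m : nat) (u : 'I_m -> C)
    (la : intpart) : C :=
  ctilde q s la * sHL q s u la.

(* Main.v *)
Require Import Defs.
From mathcomp Require Import all_boot all_order all_algebra.
From mathcomp Require Import complex.
From mathcomp Require Import boolp classical_sets functions cardinality fsbigop.
From mathcomp Require Import reals.
From mathcomp Require Import topology normedtype sequences ring zify.

(* Record a partition by its column multiplicities.  On functions of partitions
   the row operator T_u of the stable spin Hall-Littlewood functions acts with the
   weights w_u.  Conjugating W_x by ctilde turns the row operator of the spin
   q-Whittaker polynomials into an operator S_x whose weight in each column is a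
   q-Hahn weight depending only on the resulting multiplicity p and the number b'
   of particles entering from the right.  A Yang-Baxter equation
     A * R = R * B,
     R = [[1 - s u q^b, u (x + s q^b)], [1 - q^(b+1), q^(b+1) + u x]]
   relates the column operators of T_u S_x and of S_x T_u.  The left boundary
   vector is an eigenvector of R, so (1 - s u) T_u S_x = (1 + u x) S_x T_u on
   functions of partitions with bounded columns.  Hence
   la |-> ctilde_la * F_la'(x_1, ..., x_n) = (S_{x_n} ... S_{x_1} delta_empty)(la)
   is an eigenfunction of every T_u, with eigenvalue
   prod_j (1 + u x_j)/(1 - s u) and value 1 at the empty partition; applying
   T_{u_m}, ..., T_{u_1} in turn gives the identity. *)

Set Implicit Arguments.
Unset Strict Implicit.
Unset Printing Implicit Defensive.

Import Order.TTheory GRing.Theory Num.Theory.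
Import numFieldNormedType.Exports.

Local Open Scope classical_set_scope.
Local Open Scope ring_scope.

(** * Finitely supported sums and infinite products *)

Lemma fsbig_seq_supp (C : nmodType) (I : choiceType) (D : set I) (r : seq I)
    (f : I -> C) : uniq r -> (forall i, i \in r -> D i) ->
  (forall i, D i -> f i != 0 -> i \in r) ->
  \sum_(i \in D) f i = \sum_(i <- r) f i.
Proof.
move=> ur rD fr; rewrite (fsbig_seq _ _ ur) /=; apply/esym/fsbig_widen.
  by move=> i /rD.
move=> i /= [Di ri]; apply/eqP/negP => /negP /(fr _ Di) ir; exact: ri.
Qed.

Lemma fsbig_neq0 (C : nmodType) (I : choiceType) (D : set I) (f : I -> C) :
  \sum_(i \in D) f i != 0 -> exists2 i, D i & f i != 0.
Proof.
apply: contraPP => h; apply/negP; rewrite negbK; apply/eqP.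
apply: fsbig1 => i Di; apply/eqP/negP => /negP fi; apply: h; by exists i.
Qed.

Lemma iprod_finite (C : numFieldType) (f : nat -> C) (N : nat) :
  (forall c, (N <= c)%N -> f c = 1) -> iprod f = \prod_(c < N) f c.
Proof.
move=> f1; rewrite /iprod; apply: lim_near_cst => //.
exists N => // M /= NM; rewrite -(subnKC NM) big_split_ord /=.
by rewrite [X in _ * X]big1 ?mulr1 // => i _; apply: f1; rewrite leq_addr.
Qed.

(** One vanishing factor makes all later partial products 0, hence the limit 0. This is how a
    nonzero weight yields particle conservation in every column. *)
Lemma iprod_neq0 (C : numFieldType) (f : nat -> C) :
  iprod f != 0 -> forall c, f c != 0.
Proof.
move=> + c; apply: contra_neq => fc0; rewrite /iprod; apply: lim_near_cst => //.
by exists c.+1 => // M /= cM; apply/eqP/prodf_eq0; exists (Ordinal cM); rewrite ?fc0.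
Qed.

Lemma iota_index n : iota 0 n = index_iota 0 n.
Proof. by rewrite /index_iota subn0. Qed.

(** * Finite enumerations *)

Section Words.
Variables (T : eqType).

Fixpoint words (A : seq T) (N : nat) : seq (seq T) :=
  if N is N'.+1 then [seq a :: w | a <- A, w <- words A N'] else [:: [::]].

Lemma mem_words A N w :
  (w \in words A N) = (size w == N) && all [in A] w.
Proof.
elim: N w => [|N IH] [|a w] //=.
  by apply/allpairsP => -[[b v] /= [_ _]].
rewrite eqSS; apply/allpairsP/idP => [[[b v] /= [bA]]|].
  by rewrite IH => /andP[sv vA] [-> ->]; rewrite sv bA vA.
by move=> /and3P[sw aA wA]; exists (a, w); rewrite /= IH sw aA wA.
Qed.

Lemma words_uniq A N : uniq A -> uniq (words A N).
Proof.
move=> uA; elim: N => //= N IH; apply: allpairs_uniq => //.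
by move=> [a v] [b w] /= _ _ [-> ->].
Qed.

Lemma big_words (C : nmodType) A N (F : seq T -> C) :
  \sum_(w <- words A N.+1) F w = \sum_(a <- A) \sum_(w <- words A N) F (a :: w).
Proof. by rewrite /= big_allpairs_dep. Qed.

Lemma words_sub A B N : {subset A <= B} -> {subset words A N <= words B N}.
Proof.
move=> AB w; rewrite !mem_words => /andP[-> /=]; exact: sub_all.
Qed.

End Words.

(** Truncated states: the multiplicities of the columns 1 to [N], each bounded by the cutoff [K]. *)
Definition box (N K : nat) := words (iota 0 K.+1) N.

Lemma mem_box N K v : (v \in box N K) = (size v == N) && all (leq^~ K) v.
Proof.
rewrite mem_words; congr (_ && _); apply: eq_all => i.
by rewrite -[LHS]/(i \in iota 0 K.+1) mem_iota add0n ltnS.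
Qed.

Lemma box_uniq N K : uniq (box N K).
Proof. by rewrite words_uniq // iota_uniq. Qed.

Lemma box0 N : box N 0 = [:: nseq N 0%N].
Proof. by rewrite /box; elim: N => //= N ->. Qed.

Lemma box_le N K K' : (K <= K')%N -> {subset box N K <= box N K'}.
Proof.
move=> KK'; apply: words_sub => i; rewrite !mem_iota /= !add0n !ltnS => h.
exact: leq_trans KK'.
Qed.

Lemma box_widen (C : nmodType) (N K K' : nat) (F : seq nat -> C) :
  (K <= K')%N -> (forall v, v \in box N K' -> F v != 0 -> v \in box N K) ->
  \sum_(v <- box N K) F v = \sum_(v <- box N K') F v.
Proof.
move=> KK' h.
rewrite -(@fsbig_seq_supp _ _ [set` box N K'] (box N K)) ?box_uniq //; first last.
  exact: box_le.
by rewrite -(@fsbig_seq_supp _ _ [set` box N K'] (box N K')) ?box_uniq.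
Qed.

Lemma big_iota_only (C : nmodType) (K k : nat) (F : nat -> C) : (k <= K)%N ->
  (forall i, i != k -> F i = 0) -> \sum_(i <- iota 0 K.+1) F i = F k.
Proof.
move=> kK F0; have kin : k \in iota 0 K.+1 by rewrite mem_iota.
rewrite (bigD1_seq k kin (iota_uniq _ _)).
by rewrite big1 //= addr0.
Qed.

Section RowKernel.
Variables (C : numFieldType) (T : eqType) (A : seq T) (d : T).
Variables (wt : nat -> T -> nat -> T -> C).

(** A row of a vertex model as a product of column transfer matrices: [j] enters on the left, [d] is
    the label required at the right end, and [A] lists the admissible labels. *)
Fixpoint rowker (j : T) (mu la : seq nat) : C :=
  match mu, la with
  | i :: mu', k :: la' => \sum_(l <- A) wt i j k l * rowker l mu' la'
  | [::], [::] => (j == d)%:R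
  | _, _ => 0
  end.

(** A word of length [N] holds the labels entering the columns; the label leaving the last column is
    the default [d] of [nth]. The factor [F] is arbitrary so that the induction can put the weight
    of the first column in its place. *)
Lemma rowker_sum (N : nat) (F : T -> C) (mu la : seq nat) :
  uniq A -> d \in A -> size mu = N -> size la = N ->
  \sum_(h <- words A N) (F (nth d h 0) *
     \prod_(c < N) wt (nth 0%N mu c) (nth d h c) (nth 0%N la c) (nth d h c.+1)) =
  \sum_(j <- A) F j * rowker j mu la.
Proof.
move=> uA dA; elim: N F mu la => [|N IH] F.
  move=> [|//] [|//] _ _ /=; rewrite big_seq1 big_ord0 mulr1.
  rewrite (bigD1_seq d) //= eqxx mulr1 big1 ?addr0 // => j.
  by case: eqP; rewrite // mulr0.
move=> [//|i mu] [//|k la] [smu] [sla].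
rewrite big_words; apply: eq_bigr => j _ /=.
under eq_bigr do rewrite big_ord_recl /=.
rewrite -mulr_sumr; congr (_ * _).
by rewrite -(IH (fun l => wt i j k l)).
Qed.

End RowKernel.

(** * Exchange relation *)

Section Exchange.
Variables (C : numFieldType) (q s x u : C).
Hypothesis hq : forall k, 1 - q ^+ k.+1 != 0.
Hypothesis hs : forall k, 1 - s ^+ 2 * q ^+ k != 0.
Hypothesis hu : 1 - s * u != 0.

Lemma qpochS (a : C) k : qpoch q a k.+1 = qpoch q a k * (1 - a * q ^+ k).
Proof. by rewrite /qpoch big_ord_recr. Qed.

Lemma qpoch0 (a : C) : qpoch q a 0 = 1.
Proof. by rewrite /qpoch big_ord0. Qed.

Lemma xpochS k : xpoch q s x k.+1 = xpoch q s x k * (x + s * q ^+ k).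
Proof. by rewrite /xpoch big_ord_recr. Qed.

Lemma xpoch0 : xpoch q s x 0 = 1.
Proof. by rewrite /xpoch big_ord0. Qed.

Lemma qpoch_qqS k : qpoch q q k.+1 = qpoch q q k * (1 - q ^+ k.+1).
Proof. by rewrite qpochS -exprS. Qed.

Lemma qpoch_q_neq0 k : qpoch q q k != 0.
Proof. by apply/prodf_neq0 => i _; rewrite -exprS hq. Qed.

Lemma qpoch_s_neq0 k : qpoch q (s ^+ 2) k != 0.
Proof. by apply/prodf_neq0 => i _; rewrite hs. Qed.

(* The weight ctilde(k) W_x(i, b; k, l) / ctilde(i), which no longer depends on
   b and k. *)
Definition qhahn (l i : nat) : C :=
  if (l <= i)%N then
    xpoch q s x l * qpoch q (- (s * x)) (i - l) * qpoch q q i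
      / (qpoch q q l * qpoch q q (i - l) * qpoch q (s ^+ 2) i)
  else 0.

Lemma qhahn_gt l i : (i < l)%N -> qhahn l i = 0.
Proof. by move=> il; rewrite /qhahn leqNgt il. Qed.

(* The common factor [Y] keeps the four neighbouring weights polynomial where
   quotients of them could vanish. *)
Lemma qhahn_quad b e : exists Y,
  [/\ qhahn b (b + e).+1 = Y * (1 + s * x * q ^+ e) * (1 - q ^+ b.+1),
      qhahn b.+1 (b + e).+1 = Y * (x + s * q ^+ b) * (1 - q ^+ e.+1),
      qhahn b (b + e) * (1 - q ^+ (b + e).+1) =
        Y * (1 - q ^+ b.+1) * (1 - q ^+ e.+1) * (1 - s ^+ 2 * q ^+ (b + e)) &
      qhahn b.+1 (b + e).+2 * (1 - s ^+ 2 * q ^+ (b + e).+1) =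
        Y * (1 + s * x * q ^+ e) * (x + s * q ^+ b) * (1 - q ^+ (b + e).+2)].
Proof.
exists (xpoch q s x b * qpoch q (- (s * x)) e * qpoch q q (b + e).+1 /
  (qpoch q q b.+1 * qpoch q q e.+1 * qpoch q (s ^+ 2) (b + e).+1)).
have h1 := qpoch_q_neq0 b.
have h2 := qpoch_q_neq0 e.
have h3 := qpoch_s_neq0 (b + e).
have h4 := hq b.
have h5 := hq e.
have h7 := hs (b + e).
have h8 := hs (b + e).+1.
rewrite /qhahn; split.
- rewrite ifT; last by clear; lia.
  have -> : ((b + e).+1 - b = e.+1)%N by (clear; lia).
  by rewrite !qpoch_qqS !qpochS; field; rewrite ?h1 ?h2 ?h3 ?h4 ?h5 ?h7.
- rewrite ifT; last by clear; lia.
  have -> : ((b + e).+1 - b.+1 = e)%N by (clear; lia).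
  by rewrite !qpoch_qqS !qpochS xpochS; field; rewrite ?h1 ?h2 ?h3 ?h4 ?h5 ?h7.
- rewrite ifT; last by clear; lia.
  have -> : ((b + e) - b = e)%N by (clear; lia).
  by rewrite !qpoch_qqS !qpochS; field; rewrite ?h1 ?h2 ?h3 ?h4 ?h5 ?h7.
- rewrite ifT; last by clear; lia.
  have -> : ((b + e).+2 - b.+1 = e.+1)%N by (clear; lia).
  by rewrite !qpoch_qqS !qpochS xpochS; field; rewrite ?h1 ?h2 ?h3 ?h4 ?h5 ?h7 ?h8.
Qed.

(** The degenerate case e = -1 of [qhahn_quad], in which only the two diagonal weights survive. *)
Lemma qhahn_diag b :
  qhahn b.+1 b.+1 * (1 - s ^+ 2 * q ^+ b) = qhahn b b * (x + s * q ^+ b).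
Proof.
rewrite /qhahn !leqnn !subnn qpoch_qqS qpochS xpochS.
have h1 := qpoch_q_neq0 b.
have h3 := qpoch_s_neq0 b.
have h4 := hq b.
have h5 := hs b.
by field; rewrite ?h1 ?h3 ?h4 ?h5 ?qpoch0 ?oner_eq0.
Qed.

(** The degenerate case b = -1 of [qhahn_quad], in which no label leaves the column. *)
Lemma qhahn_left p :
  qhahn 0 p.+1 * (1 - s ^+ 2 * q ^+ p) = qhahn 0 p * (1 + s * x * q ^+ p).
Proof.
rewrite /qhahn !leq0n !subn0 qpoch_qqS !qpochS.
have h1 := qpoch_q_neq0 p.
have h3 := qpoch_s_neq0 p.
have h4 := hq p.
have h5 := hs p.
by field; rewrite ?h1 ?h3 ?h4 ?h5 ?qpoch0 ?oner_eq0.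
Qed.

(** Conservation determines the label [p + b - i] leaving a column, so no horizontal sum remains.
    Here [nu] is the state above the row and [la] the state below it. *)
Fixpoint qhahnker (b : nat) (nu la : seq nat) : C :=
  match nu, la with
  | i :: nu', p :: la' =>
      if (i <= p + b)%N
      then qhahn (p + b - i) p * qhahnker (p + b - i) nu' la' else 0
  | [::], [::] => (b == 0%N)%:R
  | _, _ => 0
  end.

Definition hlker := rowker [:: false; true] false (weightw q s u).

(* The parts of T_u S_x and S_x T_u to the right of a bond carrying [a] and [b];
   the entries of the intermediate state are summed up to [K]. *)
Definition hl_qhahn K a b mu la :=
  \sum_(nu <- box (size mu) K) hlker a mu nu * qhahnker b nu la.

Definition qhahn_hl K a b mu la :=
  \sum_(ka <- box (size mu) K) qhahnker b mu ka * hlker a ka la.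

Lemma hlker_cons a i k mu nu : hlker a (i :: mu) (k :: nu) =
  weightw q s u i a k false * hlker false mu nu +
  weightw q s u i a k true * hlker true mu nu.
Proof. by rewrite /hlker /= big_cons big_seq1. Qed.

(** The q-Hahn weight of the first column at intermediate multiplicity [k], times all columns to its
    right; [a] is the label that the Hall-Littlewood row hands on to them. *)
Definition hl_qhahn_step K b p mu la a k : C :=
  if (k <= p + b)%N
  then qhahn (p + b - k) p * hl_qhahn K a (p + b - k) mu la else 0.

Definition qhahn_hl_step K b i mu la a k : C :=
  if (i <= k + b)%N
  then qhahn (k + b - i) k * qhahn_hl K a (k + b - i) mu la else 0.

Lemma hl_qhahn_cons K a b i mu p la :
  hl_qhahn K a b (i :: mu) (p :: la) =
  \sum_(k <- iota 0 K.+1) weightw q s u i a k false * hl_qhahn_step K b p mu la false k +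
  \sum_(k <- iota 0 K.+1) weightw q s u i a k true * hl_qhahn_step K b p mu la true k.
Proof.
rewrite /hl_qhahn [size _]/= /box big_words -big_split.
apply: eq_bigr => k _; rewrite [RHS]/=.
rewrite /hl_qhahn_step; under eq_bigr => nu _ do rewrite hlker_cons [qhahnker _ _ _]/=.
case: ifP => _; last by rewrite !mulr0 addr0 big1 // => nu _; rewrite mulr0.
rewrite !mulr_sumr -big_split; apply: eq_bigr => nu _; rewrite [RHS]/=; ring.
Qed.

Lemma qhahn_hl_cons K a b i mu p la :
  qhahn_hl K a b (i :: mu) (p :: la) =
  \sum_(k <- iota 0 K.+1) weightw q s u k a p false * qhahn_hl_step K b i mu la false k +
  \sum_(k <- iota 0 K.+1) weightw q s u k a p true * qhahn_hl_step K b i mu la true k.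
Proof.
rewrite /qhahn_hl [size _]/= /box big_words -big_split.
apply: eq_bigr => k _; rewrite [RHS]/=.
rewrite /qhahn_hl_step; under eq_bigr => nu _ do rewrite hlker_cons [qhahnker _ _ _]/=.
case: ifP => _; last by rewrite !mulr0 addr0 big1 // => nu _; rewrite mul0r.
rewrite !mulr_sumr -big_split; apply: eq_bigr => nu _; rewrite [RHS]/=; ring.
Qed.

(** Conservation in [weightw] fixes the intermediate multiplicity for each outgoing label, so at
    most two terms remain; the bound on [i] keeps them below the cutoff. The three lemmas that
    follow treat the other label and the other order in the same way. *)
Lemma hl_qhahn_false K b i mu p la : (i <= K)%N ->
  hl_qhahn K false b (i :: mu) (p :: la) =
  (1 - s * q ^+ i * u) / (1 - s * u) * hl_qhahn_step K b p mu la false i +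
  (if i is i'.+1 then
   (1 - s ^+ 2 * q ^+ i') * u / (1 - s * u) * hl_qhahn_step K b p mu la true i' else 0).
Proof.
move=> iK; rewrite hl_qhahn_cons; congr (_ + _).
  rewrite (big_iota_only iK).
    by rewrite /weightw eqxx.
  by move=> k ki; rewrite /weightw !addn0 eq_sym (negbTE ki) mul0r.
case: i iK => [|i] iK.
  by rewrite big1 // => k _; rewrite /weightw addn1 mul0r.
rewrite (@big_iota_only _ _ i); first by rewrite /weightw addn0 addn1 eqxx.
  exact: ltnW.
by move=> k ki; rewrite /weightw addn0 addn1 eqSS eq_sym (negbTE ki) mul0r.
Qed.

Lemma hl_qhahn_true K b i mu p la : (i < K)%N ->
  hl_qhahn K true b (i :: mu) (p :: la) =
  (1 - q ^+ i.+1) / (1 - s * u) * hl_qhahn_step K b p mu la false i.+1 +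
  (u - s * q ^+ i) / (1 - s * u) * hl_qhahn_step K b p mu la true i.
Proof.
move=> iK; rewrite hl_qhahn_cons; congr (_ + _).
  rewrite (big_iota_only iK).
    by rewrite /weightw addn0 addn1 eqxx.
  by move=> k ki; rewrite /weightw addn0 addn1 eq_sym (negbTE ki) mul0r.
rewrite (big_iota_only (ltnW iK)); first by rewrite /weightw eqxx.
by move=> k ki; rewrite /weightw !addn1 eqSS eq_sym (negbTE ki) mul0r.
Qed.

Lemma qhahn_hl_false K b i mu p la : (p < K)%N ->
  qhahn_hl K false b (i :: mu) (p :: la) =
  (1 - s * q ^+ p * u) / (1 - s * u) * qhahn_hl_step K b i mu la false p +
  (1 - s ^+ 2 * q ^+ p) * u / (1 - s * u) * qhahn_hl_step K b i mu la true p.+1.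
Proof.
move=> pK; rewrite qhahn_hl_cons; congr (_ + _).
  rewrite (big_iota_only (ltnW pK)); first by rewrite /weightw eqxx.
  by move=> k ki; rewrite /weightw !addn0 (negbTE ki) mul0r.
rewrite (big_iota_only pK); first by rewrite /weightw addn0 addn1 eqxx.
by move=> k ki; rewrite /weightw addn0 addn1 (negbTE ki) mul0r.
Qed.

Lemma qhahn_hl_true K b i mu p la : (p <= K)%N ->
  qhahn_hl K true b (i :: mu) (p :: la) =
  (if p is p'.+1 then
   (1 - q ^+ p) / (1 - s * u) * qhahn_hl_step K b i mu la false p' else 0) +
  (u - s * q ^+ p) / (1 - s * u) * qhahn_hl_step K b i mu la true p.
Proof.
move=> pK; rewrite qhahn_hl_cons; congr (_ + _); last first.
  rewrite (big_iota_only pK); first by rewrite /weightw eqxx.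
  by move=> k ki; rewrite /weightw !addn1 eqSS (negbTE ki) mul0r.
case: p pK => [|p] pK.
  by rewrite big1 // => k _; rewrite /weightw addn1 mul0r.
rewrite (@big_iota_only _ _ p); first by rewrite /weightw addn0 addn1 eqxx.
  exact: ltnW.
by move=> k ki; rewrite /weightw addn0 addn1 eqSS (negbTE ki) mul0r.
Qed.

Lemma hl_qhahn_nil K a b : hl_qhahn K a b [::] [::] = (~~ a && (b == 0%N))%:R.
Proof. by rewrite /hl_qhahn big_seq1 /= -natrM mulnb; case: a. Qed.

Lemma qhahn_hl_nil K a b : qhahn_hl K a b [::] [::] = (~~ a && (b == 0%N))%:R.
Proof. by rewrite /qhahn_hl big_seq1 /= -natrM mulnb andbC; case: a. Qed.

Lemma qhahn00 : qhahn 0 0 = 1.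
Proof. by rewrite /qhahn /= xpoch0 !qpoch0 !mulr1 divr1. Qed.

Lemma hl_qhahn_step_eq K b p mu la a k c : (k + c = p + b)%N ->
  hl_qhahn_step K b p mu la a k = qhahn c p * hl_qhahn K a c mu la.
Proof.
by rewrite /hl_qhahn_step => <-; rewrite leq_addr addKn.
Qed.

Lemma qhahn_hl_step_eq K b i mu la a k c : (i + c = k + b)%N ->
  qhahn_hl_step K b i mu la a k = qhahn c k * qhahn_hl K a c mu la.
Proof.
by rewrite /qhahn_hl_step => <-; rewrite leq_addr addKn.
Qed.

(** For [p + b < k] the label handed on would be negative; for [k < b] it is [p + b - k > p], where
    the q-Hahn weight vanishes. *)
Lemma hl_qhahn_step_eq0 K b p mu la a k : (p + b < k)%N || (k < b)%N ->
  hl_qhahn_step K b p mu la a k = 0.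
Proof.
rewrite /hl_qhahn_step; case: leqP => //= kpb kb.
by rewrite qhahn_gt ?mul0r //; move: kpb kb; clear; lia.
Qed.

Lemma qhahn_hl_step_eq0 K b i mu la a k : (k + b < i)%N || (i < b)%N ->
  qhahn_hl_step K b i mu la a k = 0.
Proof.
rewrite /qhahn_hl_step; case: leqP => //= kpb kb.
by rewrite qhahn_gt ?mul0r //; move: kpb kb; clear; lia.
Qed.

Lemma hl_qhahn_step_nil K b a k :
  hl_qhahn_step K b 0 [::] [::] a k = (~~ a && (b == k))%:R.
Proof.
case: (eqVneq b k) => [->|bk].
  by rewrite (@hl_qhahn_step_eq _ _ _ _ _ _ _ 0) ?addn0 // hl_qhahn_nil qhahn00 mul1r.
rewrite andbF; case: (ltngtP b k) bk => // bk _.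
  by rewrite hl_qhahn_step_eq0 // add0n bk.
by rewrite hl_qhahn_step_eq0 // bk orbT.
Qed.

Lemma qhahn_hl_step_nil K b a i :
  qhahn_hl_step K b i [::] [::] a 0 = (~~ a && (b == i))%:R.
Proof.
case: (eqVneq b i) => [->|bk].
  by rewrite (@qhahn_hl_step_eq _ _ _ _ _ _ _ 0) ?addn0 // qhahn_hl_nil qhahn00 mul1r.
rewrite andbF; case: (ltngtP b i) bk => // bk _.
  by rewrite qhahn_hl_step_eq0 // add0n bk.
by rewrite qhahn_hl_step_eq0 // bk orbT.
Qed.

(* The exchange conserves a - b, so that the R-matrix acts on the pairs (0, b),
   (1, b + 1) and on the single state (1, 0). *)
Definition exchanged K mu la := [/\
  forall b, hl_qhahn K false b mu la =
    ((1 - s * u * q ^+ b) * qhahn_hl K false b mu la +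
     u * (x + s * q ^+ b) * qhahn_hl K true b.+1 mu la) / (1 - s * u),
  forall b, hl_qhahn K true b.+1 mu la =
    ((1 - q ^+ b.+1) * qhahn_hl K false b mu la +
     (q ^+ b.+1 + u * x) * qhahn_hl K true b.+1 mu la) / (1 - s * u) &
  hl_qhahn K true 0 mu la = (1 + u * x) * qhahn_hl K true 0 mu la / (1 - s * u)].

(** The relation fails for zero columns, where its second equation at b = 0 would read 0 = (1 -
    q)/(1 - su). The induction therefore starts from a last column that is empty in [la]: there
    [qhahn_hl] vanishes for the label 1, and only the first column of R is tested. *)
Lemma exchanged_base K i : (i < K)%N -> exchanged K [:: i] [:: 0%N].
Proof.
move=> iK; have K0 : (0 < K)%N by exact: leq_trans iK.
have A0 b : hl_qhahn K false b [:: i] [:: 0%N] =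
    (1 - s * q ^+ i * u) / (1 - s * u) * (b == i)%:R.
  rewrite hl_qhahn_false ?(ltnW iK) // hl_qhahn_step_nil /=.
  by case: (i) => [|i']; rewrite ?hl_qhahn_step_nil ?mulr0 addr0.
have A1 b : hl_qhahn K true b [:: i] [:: 0%N] =
    (1 - q ^+ i.+1) / (1 - s * u) * (b == i.+1)%:R.
  by rewrite hl_qhahn_true // !hl_qhahn_step_nil /= mulr0 addr0.
have B0 b : qhahn_hl K false b [:: i] [:: 0%N] = (b == i)%:R.
  rewrite qhahn_hl_false // qhahn_hl_step_nil /= expr0 mulr1 divff // mul1r.
  rewrite [qhahn_hl_step _ _ _ _ _ _ _](_ : _ = 0) ?mulr0 ?addr0 //.
  rewrite /qhahn_hl_step; case: ifP => // _.
  by rewrite qhahn_hl_nil mulr0.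
have B1 b : qhahn_hl K true b [:: i] [:: 0%N] = 0.
  by rewrite qhahn_hl_true // qhahn_hl_step_nil mulr0 addr0.
split => [b|b|]; rewrite ?A0 ?A1 ?B0 ?B1 ?eqSS ?mulr0 ?mul0r ?addr0 //.
  by case: eqVneq => [->|_]; rewrite ?mulr0 ?mul0r //; field.
by case: eqVneq => [->|_]; rewrite ?mulr0 ?mul0r //; field.
Qed.

(** The Yang-Baxter step. Peeling off the first column writes both sides through the quantities of
    the remaining columns; the hypothesis moves these to a common basis, and the coefficients then
    agree as rational functions. *)
Lemma exchanged_cons K i mu p la : (i < K)%N -> (p < K)%N ->
  exchanged K mu la -> exchanged K (i :: mu) (p :: la).
Proof.
move=> iK pK [E0 E1 E2].
have iK' := ltnW iK; have pK' := ltnW pK.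
(* The two-dimensional sectors (0, b), (1, b + 1) come first; the state (1, 0) is treated at the
   end. *)
have src b : hl_qhahn K false b (i :: mu) (p :: la) =
    ((1 - s * u * q ^+ b) * qhahn_hl K false b (i :: mu) (p :: la) +
     u * (x + s * q ^+ b) * qhahn_hl K true b.+1 (i :: mu) (p :: la)) / (1 - s * u)
  /\ hl_qhahn K true b.+1 (i :: mu) (p :: la) =
    ((1 - q ^+ b.+1) * qhahn_hl K false b (i :: mu) (p :: la) +
     (q ^+ b.+1 + u * x) * qhahn_hl K true b.+1 (i :: mu) (p :: la)) / (1 - s * u).
  rewrite hl_qhahn_false // hl_qhahn_true // qhahn_hl_false // qhahn_hl_true //.
  case: (ltnP i b) => ib.
    have A k c a : (k < c)%N -> hl_qhahn_step K c p mu la a k = 0.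
      by move=> kc; rewrite hl_qhahn_step_eq0 // kc orbT.
    have B k c a : (b <= c)%N -> qhahn_hl_step K c i mu la a k = 0.
      by move=> bc; rewrite qhahn_hl_step_eq0 // (leq_trans ib bc) orbT.
    rewrite (A i b false) // (A i.+1 b.+1 false) // (A i b.+1 true) ?(leqW ib) //.
    rewrite (B p b false) // (B p.+1 b true) // (B p b.+1 true) ?leqnSn //.
    have -> : (if i is i'.+1 then (1 - s ^+ 2 * q ^+ i') * u / (1 - s * u) *
        hl_qhahn_step K b p mu la true i' else 0) = 0.
      by case: (i) ib A => // i' ib A; rewrite (A i' b true) ?mulr0 // ltnW.
    have -> : (if p is p'.+1 then (1 - q ^+ p) / (1 - s * u) *
        qhahn_hl_step K b.+1 i mu la false p' else 0) = 0.
      by case: (p) B => // p' B; rewrite (B p' b.+1 false) ?mulr0 // leqnSn.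
    by rewrite !mulr0 !addr0 !mulr0 !addr0 !mul0r.
  (* By conservation the remaining columns receive (0, p - d) or (1, p - d + 1) on both sides, so
     the cases follow the sign of p - d. *)
  have [d di] : exists d, i = (b + d)%N by exists (i - b)%N; move: ib; clear; lia.
  subst i.
  case: (ltnP p d) => pd.
    case: d ib iK iK' pd => // d ib iK iK' pd.
    rewrite addnS.
    rewrite !(@hl_qhahn_step_eq0 _ _ _ _ _ false)
      ?(@qhahn_hl_step_eq0 _ _ _ _ _ false); try by lia.
    have -> : (if p is p'.+1 then (1 - q ^+ p) / (1 - s * u) *
        qhahn_hl_step K b.+1 (b + d).+1 mu la false p' else 0) = 0.
      case: (p) pd => // p' pd; rewrite qhahn_hl_step_eq0 ?mulr0 //.
      by move: pd; clear; lia.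
    case: (ltnP p d) => pd'.
      rewrite !hl_qhahn_step_eq0 ?qhahn_hl_step_eq0; try by lia.
      by rewrite !(mulr0, addr0, mul0r).
    (* Here the difference is -1: the remaining columns carry only the state (1, 0), so [E2]
       applies. *)
    have dp : d = p by apply/eqP; rewrite eqn_leq pd' -ltnS pd.
    subst d.
    rewrite (@hl_qhahn_step_eq _ _ _ _ _ _ _ 0); last by rewrite addn0 addnC.
    rewrite (@hl_qhahn_step_eq _ _ _ _ _ _ _ 0); last by rewrite addn0 addnS addnC.
    rewrite !(@qhahn_hl_step_eq _ _ _ _ _ _ _ 0); try by lia.
    rewrite E2.
    have -> : qhahn 0 p.+1 = qhahn 0 p * (1 + s * x * q ^+ p) /
        (1 - s ^+ 2 * q ^+ p).
      by rewrite -qhahn_left mulfK.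
    have hp := hs p; move: hp; rewrite ![q ^+ _.+1]exprS ![q ^+ (_ + _)]exprD.
    by move=> hp; split; field; rewrite ?hp ?hu.
  have [b' bp] : exists b', p = (b' + d)%N by exists (p - d)%N; move: pd; clear; lia.
  subst p.
  (* For d = 0, that is i = b, the surviving q-Hahn weights are diagonal. *)
  case: d ib iK iK' pK pK' pd => [|e] ib iK iK' pK pK' pd.
    rewrite !addn0.
    have -> : (if b is i'.+1 then (1 - s ^+ 2 * q ^+ i') * u / (1 - s * u) *
        hl_qhahn_step K b b' mu la true i' else 0) = 0.
      by case: (b) => // i'; rewrite hl_qhahn_step_eq0 ?mulr0 // leqnn orbT.
    have -> : (if b' is p'.+1 then (1 - q ^+ b') / (1 - s * u) *
        qhahn_hl_step K b.+1 b mu la false p' else 0) = 0.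
      by case: (b') => // p'; rewrite qhahn_hl_step_eq0 ?mulr0 // leqnn orbT.
    rewrite !(@hl_qhahn_step_eq _ _ _ _ _ false _ b'); try by lia.
    rewrite (@hl_qhahn_step_eq0 _ _ _ _ _ true) ?leqnn ?orbT //.
    rewrite (@qhahn_hl_step_eq _ _ _ _ _ false _ b'); last by lia.
    rewrite (@qhahn_hl_step_eq _ _ _ _ _ true _ b'.+1); last by lia.
    rewrite (@qhahn_hl_step_eq0 _ _ _ _ _ true) ?leqnn ?orbT //.
    have hp := hs b'.
    have -> : qhahn b'.+1 b'.+1 = qhahn b' b' * (x + s * q ^+ b') /
        (1 - s ^+ 2 * q ^+ b').
      by rewrite -qhahn_diag mulfK.
    rewrite E0 ![q ^+ _.+1]exprS.
    by split; field; rewrite ?hp ?hu.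
  (* The generic case d = e + 1: all four neighbouring weights occur, and [Y] is their common
     factor. *)
  have [Y [Y1 Y2 Y3 Y4]] := qhahn_quad b' e.
  rewrite !addnS.
  rewrite !(@hl_qhahn_step_eq _ _ _ _ _ false _ b'); try by lia.
  rewrite !(@hl_qhahn_step_eq _ _ _ _ _ true _ b'.+1); try by lia.
  rewrite !(@qhahn_hl_step_eq _ _ _ _ _ false _ b'); try by lia.
  rewrite !(@qhahn_hl_step_eq _ _ _ _ _ true _ b'.+1); try by lia.
  have hp := hs (b' + e).+1; have hq1 := hq (b' + e).
  rewrite Y1 Y2 (canRL (mulfK hq1) Y3) (canRL (mulfK hp) Y4) E0 E1.
  move: hp hq1; rewrite ![q ^+ _.+1]exprS ![q ^+ (_ + _)]exprD => hp hq1.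
  by split; field; rewrite ?hp ?hu ?hq1.
split=> [b|b|]; [by case: (src b)|by case: (src b)|].
(* The state (1, 0): for p < i everything vanishes, for p > i the remaining columns are in a
   two-dimensional sector, and for p = i again in the state (1, 0). *)
rewrite hl_qhahn_true // qhahn_hl_true //.
case: (ltngtP p i) => pi.
- rewrite !hl_qhahn_step_eq0 ?addn0 ?pi //; last by lia.
  rewrite (@qhahn_hl_step_eq0 _ _ _ _ _ true) ?addn0 ?pi //.
  have -> : (if p is p'.+1 then (1 - q ^+ p) / (1 - s * u) *
      qhahn_hl_step K 0 i mu la false p' else 0) = 0.
    by case: (p) pi => // p' pi; rewrite qhahn_hl_step_eq0 ?mulr0 // addn0 ltnW.
  by rewrite !(mulr0, addr0, mul0r).
- have [b' bp] : exists b', p = (b' + i).+1 by exists (p - i.+1)%N; move: pi; clear; lia.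
  subst p.
  have [Y [Y1 Y2 Y3 Y4]] := qhahn_quad b' i.
  rewrite (@hl_qhahn_step_eq _ _ _ _ _ false _ b'); last by lia.
  rewrite (@hl_qhahn_step_eq _ _ _ _ _ true _ b'.+1); last by lia.
  rewrite (@qhahn_hl_step_eq _ _ _ _ _ false _ b'); last by lia.
  rewrite (@qhahn_hl_step_eq _ _ _ _ _ true _ b'.+1); last by lia.
  have hq1 := hq (b' + i).
  rewrite Y1 Y2 (canRL (mulfK hq1) Y3) E0 E1.
  move: hq1; rewrite ![q ^+ _.+1]exprS ![q ^+ (_ + _)]exprD => hq1.
  by field; rewrite ?hu ?hq1.
- subst p.
  rewrite (@hl_qhahn_step_eq0 _ _ _ _ _ false) ?addn0 ?leqnn //.
  rewrite (@hl_qhahn_step_eq _ _ _ _ _ true _ 0) //.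
  rewrite (@qhahn_hl_step_eq _ _ _ _ _ true _ 0) //.
  have -> : (if i is p'.+1 then (1 - q ^+ i) / (1 - s * u) *
      qhahn_hl_step K 0 i mu la false p' else 0) = 0.
    by case: (i) => // p'; rewrite qhahn_hl_step_eq0 ?mulr0 // addn0 leqnn.
  by rewrite E2; field.
Qed.

(** The default 1 of [last] excludes empty lists, for which the relation is false. The strict bounds
    leave room below [K] for the intermediate states. *)
Lemma exchange K mu la : size mu = size la ->
  all (ltn^~ K) mu -> all (ltn^~ K) la -> last 1%N la = 0%N -> exchanged K mu la.
Proof.
elim: la mu => [//|p la IH] [//|i mu] [smu] /andP[iK muK] /andP[pK laK].
case: la mu laK muK IH smu => [|p' la] [|i' mu] // laK muK IH smu la0.
  by move: la0 => /= ->; exact: exchanged_base.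
by apply: exchanged_cons => //; exact: IH.
Qed.

(** * Left boundary and commutation of the row operators *)

Definition hl_op mu nu : C := hlker false mu nu + u * hlker true mu nu.

Definition left_boundary b : C := xpoch q s x b / qpoch q q b.

(** The matrix of S_x. The entering label is cut at [K], which is harmless once the entries of [nu]
    are at most [K], by [qhahn_op_widen]. *)
Definition qhahn_op K nu la : C :=
  \sum_(b <- iota 0 K.+1) left_boundary b * qhahnker b nu la.

Lemma left_boundaryS b :
  left_boundary b.+1 * (1 - q ^+ b.+1) = left_boundary b * (x + s * q ^+ b).
Proof.
rewrite /left_boundary qpoch_qqS xpochS.
have h1 := hq b; have h2 := qpoch_q_neq0 b.
by field; rewrite ?h1 ?h2.
Qed.

(** If [b] exceeds the first entry i, the label p + b - i leaving the first column exceeds p, and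
    its q-Hahn weight is 0. *)
Lemma qhahnker_gt b nu la : (head 0%N nu < b)%N -> qhahnker b nu la = 0.
Proof.
case: nu la => [|i nu] [|p la] //=; first by case: b.
move=> ib; case: ifP => // ipb; rewrite qhahn_gt ?mul0r //.
by move: ib; clear; lia.
Qed.

Lemma qhahn_op_widen K K' nu la : (K <= K')%N -> all (leq^~ K) nu ->
  qhahn_op K nu la = qhahn_op K' nu la.
Proof.
move=> KK' nuK; rewrite /qhahn_op -(subnKC KK') -addSn iotaD big_cat /=.
rewrite -[LHS]addr0; congr (_ + _); apply/esym/big1_seq => b /=.
rewrite mem_iota => /andP[Kb _]; rewrite qhahnker_gt ?mulr0 //.
case: nu nuK => [|i nu] /=; first by rewrite (leq_trans _ Kb).
by move=> /andP[iK _]; rewrite (leq_ltn_trans iK).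
Qed.

(** Regroups the boundary sum into the sectors preserved by R: the state (1, 0) and the pairs (0,
    b), (1, b + 1). The hypothesis closes the shift at the top label. *)
Lemma left_boundary_sum K (G : bool -> nat -> C) : G true K.+1 = 0 ->
  \sum_(b <- iota 0 K.+1) left_boundary b * (G false b + u * G true b) =
  u * G true 0 +
  \sum_(b < K.+1) (left_boundary b * G false b + u * left_boundary b.+1 * G true b.+1).
Proof.
move=> G0; rewrite iota_index big_mkord.
under eq_bigr do rewrite mulrDr mulrCA.
rewrite big_split /= [X in _ + X]big_ord_recl /= [in RHS]big_split /=.
rewrite [X in _ = _ + (_ + X)]big_ord_recr /= G0 mulr0 addr0.
rewrite /left_boundary /bump /= xpoch0 qpoch0 divr1 mul1r addrCA; congr (_ + (_ + _)).
by apply: eq_bigr => i _; rewrite add1n mulrA.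
Qed.

(** Let l_b be the left boundary weight. By [left_boundaryS], l_b (1 - s u q^b) + u l_{b+1} (1 -
    q^{b+1}) = (1 + u x) l_b and l_b u (x + s q^b) + u l_{b+1} (q^{b+1} + u x) = (1 + u x) u
    l_{b+1}, so R multiplies the boundary vector by 1 + u x. *)
Lemma hl_qhahn_op_comm K mu la : size mu = size la ->
  all (ltn^~ K) mu -> all (ltn^~ K) la -> last 1%N la = 0%N ->
  \sum_(nu <- box (size mu) K) hl_op mu nu * qhahn_op K nu la =
  (1 + u * x) / (1 - s * u) *
    \sum_(ka <- box (size mu) K) qhahn_op K mu ka * hl_op ka la.
Proof.
move=> smu muK laK la0; have [E0 E1 E2] := exchange smu muK laK la0.
have -> : \sum_(nu <- box (size mu) K) hl_op mu nu * qhahn_op K nu la =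
    \sum_(b <- iota 0 K.+1) left_boundary b *
      (hl_qhahn K false b mu la + u * hl_qhahn K true b mu la).
  under eq_bigr do rewrite mulr_sumr.
  rewrite exchange_big; apply: eq_bigr => b _.
  rewrite /hl_qhahn mulr_sumr -big_split mulr_sumr; apply: eq_bigr => nu _.
  by rewrite /hl_op [in RHS]/=; ring.
have -> : \sum_(ka <- box (size mu) K) qhahn_op K mu ka * hl_op ka la =
    \sum_(b <- iota 0 K.+1) left_boundary b *
      (qhahn_hl K false b mu la + u * qhahn_hl K true b mu la).
  under eq_bigr do rewrite mulr_suml.
  rewrite exchange_big; apply: eq_bigr => b _.
  rewrite /qhahn_hl mulr_sumr -big_split mulr_sumr; apply: eq_bigr => nu _.
  by rewrite /hl_op [in RHS]/=; ring.
rewrite (left_boundary_sum (G := fun a b => hl_qhahn K a b mu la)); last first.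
  rewrite /hl_qhahn big1_seq // => nu /andP[_].
  rewrite mem_box => /andP[_ nuK]; rewrite qhahnker_gt ?mulr0 //.
  by case: nu nuK => //= i nu /andP[].
rewrite (left_boundary_sum (G := fun a b => qhahn_hl K a b mu la)); last first.
  rewrite /qhahn_hl big1_seq // => nu /andP[_] _.
  rewrite qhahnker_gt ?mul0r //.
  by case: (mu) muK => //= i mu' /andP[iK _]; rewrite ltnW // ltnS ltnW.
rewrite mulrDr E2; congr (_ + _); first by field.
rewrite mulr_sumr.
apply: eq_bigr => b _; rewrite E0 E1.
have h1 := hq b.
have -> : left_boundary b.+1 = left_boundary b * (x + s * q ^+ b) / (1 - q ^+ b.+1).
  by rewrite -left_boundaryS mulfK.
move: h1; rewrite [q ^+ _.+1]exprS => h1.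
by field; rewrite ?h1 ?hu.
Qed.

End Exchange.

(** * Spin q-Whittaker polynomials *)

Section SpinWhittaker.
Variables (C : numFieldType) (q s : C).
Hypothesis hq : forall k, 1 - q ^+ k.+1 != 0.
Hypothesis hs : forall k, 1 - s ^+ 2 * q ^+ k != 0.

Definition ctilde_seq (v : seq nat) : C :=
  \prod_(i <- v) (qpoch q (s ^+ 2) i / qpoch q q i).

(** The conjugating factor cancels the only part of W that depends on the upper multiplicity [i]
    alone. *)
Lemma weightW_qhahn x k b i l :
  weightW q s x k b i l * (qpoch q (s ^+ 2) i / qpoch q q i) =
  if (k + b == i + l)%N
  then qhahn q s x l k * (qpoch q (s ^+ 2) k / qpoch q q k) else 0.
Proof.
have h1 := qpoch_q_neq0 hq; have h2 := qpoch_s_neq0 hs.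
rewrite /weightW /qhahn; case: eqP => _ /=; last by rewrite mul0r.
case: ifP => _; last by rewrite !mul0r.
by field; rewrite ?h1 ?h2.
Qed.

Lemma rowkerW_qhahnker K x b ka v : all (leq^~ K) ka ->
  ctilde_seq v * rowker (iota 0 K.+1) 0%N (weightW q s x) b ka v =
  qhahnker q s x b v ka * ctilde_seq ka.
Proof.
elim: ka b v => [|k ka IH] b [|i v] //; rewrite /ctilde_seq.
- by rewrite !big_nil mulrC.
- by rewrite mulr0 mul0r.
- by rewrite mulr0 mul0r.
move=> /andP[kK kaK]; rewrite !big_cons [rowker _ _ _ _ _ _]/= -/(iota 0 K.+1).
rewrite mulr_sumr.
transitivity (\sum_(l <- iota 0 K.+1) (if (k + b == i + l)%N then
    qhahn q s x l k * (qpoch q (s ^+ 2) k / qpoch q q k) *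
    (qhahnker q s x l v ka * ctilde_seq ka) else 0)).
  apply: eq_bigr => l _; rewrite mulrACA [_ * weightW _ _ _ _ _ _ _]mulrC.
  by rewrite weightW_qhahn -IH //; case: ifP; rewrite ?mul0r.
rewrite [in RHS]/=; case: leqP => ikb; last first.
  rewrite mul0r big1 // => l _; rewrite ifF //.
  by apply/negbTE; move: ikb; clear; lia.
have [lK|lK] := leqP (k + b - i) K.
  rewrite (big_iota_only lK).
    rewrite subnKC // eqxx -/(ctilde_seq ka); ring.
  by move=> l lne; rewrite ifF //; apply/negbTE; move: lne ikb; clear; lia.
(* A label beyond the cutoff exceeds [k], so its q-Hahn weight is 0, and the truncated sum is 0 as
   well. *)
rewrite qhahn_gt ?(leq_ltn_trans kK) // !mul0r big1_seq // => l /andP[_].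
rewrite mem_iota => lK'; rewrite ifF //; apply/negbTE.
by move: lK lK' ikb; clear; lia.
Qed.

(** * Configurations, enumerated row by row *)

Definition config n : choiceType :=
  (('I_n -> nat -> nat) * ('I_n.+1 -> nat -> nat))%type.

(** An arbitrary top state [V] replaces the differences of parts, so that removing the last row
    leaves an object of the same kind. *)
Definition config_to n (V : nat -> nat) : set (config n) :=
  [set hv | [/\ forall r, \forall c \near \oo, hv.1 r c = 0%N,
                forall c, hv.2 ord0 c = 0%N &
                forall c, hv.2 ord_max c = V c]].

Definition sqW_to n (x : 'I_n -> C) (V : nat -> nat) : C :=
  \sum_(hv \in @config_to n V) sqW_weight q s x hv.1 hv.2.

Lemma sqWE n (x : 'I_n -> C) la :
  sqW q s x la = sqW_to x (fun c => part la c - part la c.+1)%N.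
Proof. by []. Qed.

Definition config_ext n (hv : config n) (g V : nat -> nat) : config n.+1 :=
  (fun r => if unlift ord_max r is Some r' then hv.1 r' else g,
   fun r => if unlift ord_max r is Some r' then hv.2 r' else V).

Lemma widen_lift_max n (r : 'I_n) : widen_ord (leqnSn n) r = lift ord_max r.
Proof. by apply/ord_inj; rewrite lift_max. Qed.

Lemma unlift_widen n (r : 'I_n) : unlift ord_max (widen_ord (leqnSn n) r) = Some r.
Proof. by rewrite widen_lift_max liftK. Qed.

Definition row_weight (x : C) (mu g la : nat -> nat) : C :=
  xpoch q s x (g 0%N) / qpoch q q (g 0%N) *
  iprod (fun c => weightW q s x (mu c) (g c) (la c) (g c.+1)).

Lemma sqW_weight_recr n (x : 'I_n.+1 -> C) (hv : config n.+1) :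
  sqW_weight q s x hv.1 hv.2 =
  sqW_weight q s (fun r => x (widen_ord (leqnSn n) r))
    (fun r => hv.1 (widen_ord (leqnSn n) r))
    (fun r => hv.2 (widen_ord (leqnSn n.+1) r)) *
  row_weight (x ord_max) (hv.2 (widen_ord (leqnSn n.+1) ord_max))
    (hv.1 ord_max) (hv.2 ord_max).
Proof.
rewrite /sqW_weight big_ord_recr /row_weight /=.
have -> : lift ord0 (@ord_max n) = ord_max :> 'I_n.+2 by apply/ord_inj.
congr (_ * _); apply: eq_bigr => r _.
have -> : lift ord0 (widen_ord (leqnSn n) r) =
  widen_ord (leqnSn n.+1) (lift ord0 r) by apply/ord_inj.
by [].
Qed.

Definition config_restr n (hv : config n.+1) : config n :=
  (fun r => hv.1 (widen_ord (leqnSn n) r),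
   fun r => hv.2 (widen_ord (leqnSn n.+1) r)).

Lemma config_extK n (hv : config n) g V : config_restr (config_ext hv g V) = hv.
Proof.
case: hv => h v; rewrite /config_restr /config_ext /=; congr pair;
  by apply/funext => r; rewrite unlift_widen.
Qed.

Lemma config_restrK n (hv : config n.+1) :
  config_ext (config_restr hv) (hv.1 ord_max) (hv.2 ord_max) = hv.
Proof.
case: hv => h v; rewrite /config_restr /config_ext /=; congr pair;
  apply/funext => r; by case: unliftP => [r' ->|->] //; rewrite widen_lift_max.
Qed.

Lemma config_ext_max n (hv : config n) g V :
  (config_ext hv g V).1 ord_max = g /\ (config_ext hv g V).2 ord_max = V.
Proof. by rewrite /config_ext /= unlift_none unlift_none. Qed.

Lemma sqW_weight_ext n (x : 'I_n.+1 -> C) (hv : config n) g V :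
  sqW_weight q s x (config_ext hv g V).1 (config_ext hv g V).2 =
  sqW_weight q s (fun r => x (widen_ord (leqnSn n) r)) hv.1 hv.2 *
  row_weight (x ord_max) (hv.2 ord_max) g V.
Proof.
rewrite sqW_weight_recr; have [-> ->] := config_ext_max hv g V.
rewrite -[in RHS](config_extK hv g V) /config_restr.
by congr (_ * row_weight _ (_ _) _ _).
Qed.

Lemma weightW_neq0 x i j k l : weightW q s x i j k l != 0 ->
  (i + j = k + l)%N /\ (l <= i)%N.
Proof. by rewrite /weightW; case: ifP => [/andP[/eqP]|]; rewrite ?eqxx. Qed.

Lemma weightW0 x : weightW q s x 0 0 0 0 = 1.
Proof. by rewrite /weightW /= xpoch0 !qpoch0 !mulr1 divr1. Qed.

Lemma row_weight_neq0 x mu g la : row_weight x mu g la != 0 ->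
  forall c, (mu c + g c = la c + g c.+1)%N /\ (g c.+1 <= mu c)%N.
Proof.
rewrite /row_weight mulf_eq0 => /norP[_ /iprod_neq0 h] c.
exact: weightW_neq0 (h c).
Qed.

Lemma row_weight_sum x N K ka v : size ka = N -> size v = N ->
  \sum_(g <- box N K) row_weight x (nth 0%N ka) (nth 0%N g) (nth 0%N v) =
  \sum_(b <- iota 0 K.+1) left_boundary q s x b *
    rowker (iota 0 K.+1) 0%N (weightW q s x) b ka v.
Proof.
move=> ska sv; rewrite -(@rowker_sum _ _ _ _ _ N) ?iota_uniq ?mem_iota //.
apply: eq_big_seq => g; rewrite mem_box => /andP[/eqP sg _].
rewrite /row_weight (@iprod_finite _ _ N) // => c Nc.
by rewrite !nth_default ?weightW0 ?ska ?sv ?sg // leqW.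
Qed.

Lemma nth_zeros (v : seq nat) : all (eq_op 0%N) v -> nth 0%N v = fun=> 0%N.
Proof.
move=> /all_nthP v0; apply/funext => c; have [cv|cv] := ltnP c (size v).
  by apply/esym/eqP; exact: v0.
by rewrite nth_default.
Qed.

(** Going down one row at most doubles the bound on the entries, by [row_weight_box]; hence
    [M.*2]. *)
Fixpoint configs (n N M : nat) (v : seq nat) : seq (config n) :=
  match n with
  | 0 => if all (eq_op 0%N) v then [:: (fun _ _ => 0%N, fun _ _ => 0%N)] else [::]
  | n'.+1 =>
      [seq config_ext hv (nth 0%N p.2) (nth 0%N v)
        | p <- [seq (ka, g) | ka <- box N M.*2, g <- box N M.*2],
          hv <- configs n' N M.*2 p.1]
  end.

Lemma configs_to n N M v hv : hv \in configs n N M v -> config_to (nth 0%N v) hv.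
Proof.
elim: n M v hv => [|n IH] M v hv /=.
  case: ifP => // v0; rewrite inE => /eqP ->; rewrite nth_zeros //.
  by split => //= r; exists 0%N.
move=> /allpairsPdep[p [hv' [_ /IH[h1 h2 h3] ->]]]; split.
- move=> r; rewrite /config_ext /=; case: unliftP => [r' _|_]; first exact: h1.
  by exists (size p.2) => // c /= pc; rewrite nth_default.
- move=> c; have -> : ord0 = widen_ord (leqnSn n.+1) ord0 :> 'I_n.+2.
    exact/ord_inj.
  by rewrite /config_ext /= unlift_widen h2.
- by move=> c; case: (config_ext_max hv' (nth 0%N p.2) (nth 0%N v)) => _ ->.
Qed.

Lemma nth_inj N (v w : seq nat) : size v = N -> size w = N ->
  nth 0%N v = nth 0%N w -> v = w.
Proof.
move=> sv sw vw; apply: (@eq_from_nth _ 0%N); first by rewrite sv.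
by move=> i _; rewrite vw.
Qed.

Lemma configs_uniq n N M v : uniq (configs n N M v).
Proof.
elim: n M v => [|n IH] M v /=; first by case: ifP.
apply: allpairs_uniq_dep => //.
  by apply: allpairs_uniq; rewrite ?box_uniq // => -[a b] [c d] /= _ _ [-> ->].
move=> [p hv] [p' hv'].
move=> /allpairsPdep[p1 [hv1 [p1b hv1p [e1 e2]]]].
move=> /allpairsPdep[p2 [hv2 [p2b hv2p [e3 e4]]]].
subst p hv p' hv'; rewrite /= => e.
have ehv : hv1 = hv2.
  by rewrite -(config_extK hv1 (nth 0%N p1.2) (nth 0%N v)) e config_extK.
have eg : nth 0%N p1.2 = nth 0%N p2.2.
  have [<- _] := config_ext_max hv1 (nth 0%N p1.2) (nth 0%N v).
  by have [<- _] := config_ext_max hv2 (nth 0%N p2.2) (nth 0%N v); rewrite e.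
subst hv2; have [_ _ m1] := configs_to hv1p; have [_ _ m2] := configs_to hv2p.
(* The state below the last row is recovered as the top state of the smaller configuration. *)
have ek : nth 0%N p1.1 = nth 0%N p2.1 by apply/funext => c; rewrite -m1 m2.
move: p1b p2b eg ek {e m1 m2 hv1p hv2p} => /allpairsP[[a g] /= [ab gb ->]].
move=> /allpairsP[[a' g'] /= [ab' gb' ->]] /= eg ek.
move: ab gb ab' gb'; rewrite !mem_box.
move=> /andP[/eqP sa _] /andP[/eqP sg _] /andP[/eqP sa' _] /andP[/eqP sg' _].
by rewrite (nth_inj sa sa' ek) (nth_inj sg sg' eg).
Qed.

Lemma mkseq_box N K (f : nat -> nat) : (forall c, (f c <= K)%N) ->
  mkseq f N \in box N K.
Proof.
by move=> fK; rewrite mem_box size_mkseq eqxx; apply/allP => _ /mapP[c _ ->].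
Qed.

Lemma nth_mkseq0 N (f : nat -> nat) : (forall c, (N <= c)%N -> f c = 0%N) ->
  nth 0%N (mkseq f N) = f.
Proof.
move=> f0; apply/funext => c; have [cN|cN] := ltnP c N; first by rewrite nth_mkseq.
by rewrite nth_default ?size_mkseq // f0.
Qed.

Lemma box_nth N K v c : v \in box N K -> (nth 0%N v c <= K)%N.
Proof.
rewrite mem_box => /andP[_ /all_nthP vK].
have [cv|cv] := ltnP c (size v); first exact: vK.
by rewrite nth_default.
Qed.

(** Conservation and g(c+1) <= mu(c) give g(c) <= v(c), whence mu(c) <= v(c) + v(c+1); so [mu] and
    [g] inherit the support and at most twice the bound of [v]. *)
Lemma row_weight_box x N M mu g v : v \in box N M ->
  row_weight x mu g (nth 0%N v) != 0 ->
  exists ka g', [/\ ka \in box N M.*2, g' \in box N M.*2,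
    mu = nth 0%N ka & g = nth 0%N g'].
Proof.
move=> vb /row_weight_neq0 h.
have v0 c : (N <= c)%N -> nth 0%N v c = 0%N.
  move: vb; rewrite mem_box => /andP[/eqP sv _] Nc.
  by rewrite nth_default ?sv.
have gv c : (g c <= nth 0%N v c)%N.
  have [h1 h2] := h c; move: h1 h2; clear; lia.
have gM c : (g c <= M.*2)%N.
  by apply: leq_trans (gv c) _; have := box_nth c vb; clear; lia.
have muM c : (mu c <= M.*2)%N.
  have [h1 h2] := h c; have := box_nth c vb; have := box_nth c.+1 vb.
  have := gv c.+1; move: h1; clear; lia.
exists (mkseq mu N), (mkseq g N); split; rewrite ?mkseq_box //.
  rewrite nth_mkseq0 // => c Nc.
  have [h1 h2] := h c; have := gv c.+1.
  by move: h1; rewrite !v0 ?(leqW Nc) //; clear; lia.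
rewrite nth_mkseq0 // => c Nc.
by have := gv c; rewrite v0 // leqn0 => /eqP.
Qed.

Lemma sqW_weight_neq0_row n (x : 'I_n -> C) (hv : config n) :
  sqW_weight q s x hv.1 hv.2 != 0 -> forall r,
  row_weight (x r) (hv.2 (widen_ord (leqnSn n) r)) (hv.1 r) (hv.2 (lift ord0 r)) != 0.
Proof. by move=> /prodf_neq0 h r; exact: h. Qed.

Lemma configs_supp n N M v (x : 'I_n -> C) hv : v \in box N M ->
  config_to (nth 0%N v) hv -> sqW_weight q s x hv.1 hv.2 != 0 ->
  hv \in configs n N M v.
Proof.
elim: n M v x hv => [|n IH] M v x hv vb [h1 h2 h3].
  move=> _ /=; rewrite ifT; last first.
    apply/(all_nthP 0%N) => c _; apply/eqP; rewrite -[RHS]h3 -[LHS](h2 c).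
    by congr (hv.2 _ c); exact/ord_inj.
  rewrite inE; apply/eqP; case: hv {h1 h3} h2 => h w /= h2; congr pair.
    by apply/funext => -[].
  by apply/funext => r; rewrite ord1; apply/funext => c; rewrite h2.
rewrite sqW_weight_recr mulf_eq0 negb_or => /andP[w1 w2].
have hvm : hv.2 ord_max = nth 0%N v by apply/funext => c; rewrite h3.
rewrite hvm in w2.
have [ka [g [kab gb ek eg]]] := row_weight_box vb w2.
apply/allpairsPdep; exists (ka, g), (config_restr hv); split.
- exact: allpairs_f.
- apply: (IH _ _ (fun r => x (widen_ord (leqnSn n) r))) => //.
  split => [r|c|c]; first exact: h1.
    by rewrite -(h2 c) /=; congr (hv.2 _ c); exact/ord_inj.
  by rewrite /= ek.
- by rewrite -[LHS]config_restrK eg hvm.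
Qed.

Lemma sqW_toE n N M v (x : 'I_n -> C) : v \in box N M ->
  sqW_to x (nth 0%N v) =
  \sum_(hv <- configs n N M v) sqW_weight q s x hv.1 hv.2.
Proof.
move=> vb; apply: fsbig_seq_supp; first exact: configs_uniq.
  by move=> hv; exact: configs_to.
by move=> hv; exact: configs_supp.
Qed.

Lemma sqW_to0 N M v (x : 'I_0 -> C) : v \in box N M ->
  sqW_to x (nth 0%N v) = (all (eq_op 0%N) v)%:R.
Proof.
move=> vb; rewrite (sqW_toE _ vb) /=; case: ifP => _; last by rewrite big_nil.
by rewrite big_seq1 /sqW_weight big_ord0.
Qed.

(** The branching rule in the last variable, conjugated by ctilde: adding a row is applying S_x. *)
Lemma sqW_toS n N M v (x : 'I_n.+1 -> C) : v \in box N M ->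
  ctilde_seq v * sqW_to x (nth 0%N v) =
  \sum_(ka <- box N M.*2) qhahn_op q s (x ord_max) M.*2 v ka *
    (ctilde_seq ka * sqW_to (fun r => x (widen_ord (leqnSn n) r)) (nth 0%N ka)).
Proof.
move=> vb; rewrite (sqW_toE _ vb) /= big_allpairs_dep /= big_allpairs_dep /=.
rewrite mulr_sumr; apply: eq_big_seq => ka kab.
have [ska kaK] : size ka = N /\ all (leq^~ M.*2) ka.
  by move: kab; rewrite mem_box => /andP[/eqP].
have sv : size v = N by move: vb; rewrite mem_box => /andP[/eqP].
transitivity (ctilde_seq v * (\sum_(g <- box N M.*2)
    row_weight (x ord_max) (nth 0%N ka) (nth 0%N g) (nth 0%N v)) *
    sqW_to (fun r => x (widen_ord (leqnSn n) r)) (nth 0%N ka)).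
  rewrite -mulrA; congr (_ * _); rewrite mulr_suml.
  apply: eq_bigr => g _; rewrite (sqW_toE _ kab) mulr_sumr.
  apply: eq_big_seq => hv hvk; apply: etrans (sqW_weight_ext _ _ _ _) _.
  rewrite mulrC; congr (row_weight _ _ _ _ * _).
  by have [_ _ m] := configs_to hvk; apply/funext => c; rewrite m.
rewrite row_weight_sum // mulr_sumr mulrA; congr (_ * _).
rewrite /qhahn_op mulr_suml; apply: eq_bigr => b _.
by rewrite mulrCA rowkerW_qhahnker // mulrA.
Qed.

(** A row extends the occupied columns by at most one, since the label leaving a column is bounded
    by the multiplicity below. For [sqW] this says that the polynomial vanishes on partitions with
    more than n parts. *)
Lemma sqW_to_supp n (V : nat -> nat) (x : 'I_n -> C) : sqW_to x V != 0 ->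
  forall c, (n <= c)%N -> V c = 0%N.
Proof.
move=> /fsbig_neq0[hv [_ h2 h3] w] c nc; rewrite -h3.
have /(_ n (leqnn n)) h : forall r, (r <= n)%N -> forall c, (r <= c)%N ->
    hv.2 (inord r) c = 0%N.
  elim=> [_ c' _|r IH rn c' rc].
    by rewrite -[RHS](h2 c'); congr (hv.2 _ c'); apply/ord_inj; rewrite inordK.
  have := row_weight_neq0 (sqW_weight_neq0_row w (Ordinal rn)).
  have -> : widen_ord (leqnSn n) (Ordinal rn) = inord r.
    by apply/ord_inj; rewrite inordK //= ltnW.
  have -> : lift ord0 (Ordinal rn) = inord r.+1.
    by apply/ord_inj; rewrite inordK.
  case: c' rc => // c' rc h.
  have [e1 _] := h c'.+1; have [_ e2] := h c'.
  move: e1 e2; rewrite !IH ?(ltnW rn) ?(ltnW rc) //; clear; lia.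
by rewrite -[RHS](h c nc); congr (hv.2 _ c); apply/ord_inj; rewrite inordK.
Qed.

End SpinWhittaker.

(** * Eigenfunctions *)

Section Eigenfunction.
Variables (C : numFieldType) (q s : C).
Hypothesis hq : forall k, 1 - q ^+ k.+1 != 0.
Hypothesis hs : forall k, 1 - s ^+ 2 * q ^+ k != 0.

Lemma weightw_neq0 u i (j : bool) k (l : bool) :
  weightw q s u i j k l != 0 -> (i + j = k + l)%N.
Proof. by rewrite /weightw; case: ifP => [/eqP|_]; rewrite ?eqxx. Qed.

Lemma hlker_supp u M a mu nu : all (leq^~ M) mu ->
  hlker q s u a mu nu != 0 -> all (leq^~ M.+1) nu.
Proof.
elim: mu a nu => [|i mu IH] a [|k nu] //=; first by rewrite eqxx.
move=> /andP[iM muM]; rewrite -/(hlker _ _ _ _ _ _) => h.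
have [l] : exists l, weightw q s u i a k l * hlker q s u l mu nu != 0.
  move: h; apply: contraPP => h0; apply/negP; rewrite negbK; apply/eqP.
  by rewrite big1 // => l _; apply/eqP/negP => /negP hl; apply: h0; exists l.
rewrite mulf_eq0 => /norP[/weightw_neq0 e /(IH _ _ muM) ->].
by rewrite andbT; move: e iM; clear; case: a; case: l; lia.
Qed.

Lemma hl_op_box u N M K mu nu : mu \in box N M -> nu \in box N K ->
  hl_op q s u mu nu != 0 -> nu \in box N M.+1.
Proof.
rewrite !mem_box => /andP[_ muM] /andP[-> _] /= h.
have [e|e] := eqVneq (hlker q s u false mu nu) 0; last exact: hlker_supp e.
apply: (@hlker_supp u M true) muM _; move: h; rewrite /hl_op e add0r.
by apply: contra_neq => ->; rewrite mulr0.
Qed.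

(** By [qhahnker_gt] the label leaving a column is at most the next entry of [nu], so the new entry,
    i plus that label minus b, is at most 2M. *)
Lemma qhahnker_supp x M b nu la : all (leq^~ M) nu ->
  qhahnker q s x b nu la != 0 -> all (leq^~ M.*2) la.
Proof.
elim: nu b la => [|i nu IH] b [|p la] //=; first by rewrite eqxx.
move=> /andP[iM nuM]; case: leqP => ipb; last by rewrite eqxx.
rewrite mulf_eq0 => /norP[h1 h2]; rewrite (IH _ _ nuM h2) andbT.
have hc : (p + b - i <= M)%N.
  rewrite leqNgt; apply: contra h2 => Mc; rewrite qhahnker_gt //.
  by case: nu nuM {IH} => [|j nu] /=; [lia|case/andP=> ? _; lia].
have hb : (p + b - i <= p)%N.
  by rewrite leqNgt; apply: contra h1 => ?; rewrite qhahn_gt.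
by move: hc hb iM; clear; lia.
Qed.

Lemma qhahn_op_box x N M K nu la K' : nu \in box N M -> la \in box N K ->
  qhahn_op q s x K' nu la != 0 -> la \in box N M.*2.
Proof.
rewrite !mem_box => /andP[_ nuM] /andP[-> _] /= h.
have [b] : exists b, left_boundary q s x b * qhahnker q s x b nu la != 0.
  move: h; apply: contraPP => h0; apply/negP; rewrite negbK; apply/eqP.
  by rewrite /qhahn_op big1 // => l _; apply/eqP/negP => /negP hl; apply: h0; exists l.
by rewrite mulf_eq0 => /norP[_ /(qhahnker_supp nuM)].
Qed.

(** The eigenfunction: ctilde of a partition times the polynomial of its conjugate, as a function of
    the multiplicities [v]; see [dualWE]. *)
Definition dualW n (x : 'I_n -> C) (v : seq nat) : C :=
  ctilde_seq q s v * sqW_to q s x (nth 0%N v).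

Lemma dualWS n N M v (x : 'I_n.+1 -> C) : v \in box N M ->
  dualW x v = \sum_(ka <- box N M.*2) qhahn_op q s (x ord_max) M.*2 v ka *
    dualW (fun r => x (widen_ord (leqnSn n) r)) ka.
Proof. exact: sqW_toS. Qed.

Lemma zeros_box N K : nseq N 0%N \in box N K.
Proof. by rewrite mem_box size_nseq eqxx all_nseq orbT. Qed.

Lemma all_zeros N K v : v \in box N K -> all (eq_op 0%N) v -> v = nseq N 0%N.
Proof.
rewrite mem_box => /andP[/eqP <- _] v0; apply/all_pred1P.
by apply: sub_all v0 => i /=; rewrite eq_sym.
Qed.

Lemma ctilde_seq_zeros N : ctilde_seq q s (nseq N 0%N) = 1.
Proof.
rewrite /ctilde_seq big1_seq // => i /= /nseqP[-> _].
by rewrite !qpoch0 divr1.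
Qed.

Lemma hlker_zeros u a N mu : 1 - s * u != 0 -> size mu = N ->
  hlker q s u a mu (nseq N 0%N) = (~~ a && all (eq_op 0%N) mu)%:R.
Proof.
move=> hu; elim: N a mu => [|N IH] a [|i mu] //=; first by case: a.
move=> [smu]; rewrite big_cons big_seq1 -/(hlker _ _ _ _ _ _).
rewrite -/(hlker _ _ _ _ _ _) !IH //= mulr0 addr0 eq_sym.
case: i => [|i]; case: a => /=; rewrite /weightw /= ?mul0r ?andbF //.
by rewrite expr0 mulr1 divff ?mul1r.
Qed.

Lemma dualW0 N M v (x : 'I_0 -> C) : v \in box N M ->
  dualW x v = (v == nseq N 0%N)%:R.
Proof.
move=> vb; rewrite /dualW (sqW_to0 _ _ _ vb).
case: eqP => [->|v0].
  by rewrite all_nseq eqxx orbT ctilde_seq_zeros mulr1.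
by rewrite (_ : all _ _ = false) ?mulr0 //; apply/negP => /(all_zeros vb).
Qed.

(** Induction on the number of variables: T_u passes each S_x at the cost of (1 + u x)/(1 - s u) and
    fixes the delta function of the empty state. The condition [n < N] supplies the empty last
    column required by [exchange]. *)
Lemma dualW_eigen u n (x : 'I_n -> C) N M K mu : 1 - s * u != 0 -> (n < N)%N ->
  mu \in box N M -> (M < K)%N ->
  \sum_(nu <- box N K) hl_op q s u mu nu * dualW x nu =
  \prod_(j < n) ((1 + u * x j) / (1 - s * u)) * dualW x mu.
Proof.
move=> hu; elim: n x M K mu => [|n IH] x M K mu nN mub MK.
  rewrite big_ord0 mul1r (bigD1_seq (nseq N 0%N)) ?zeros_box ?box_uniq //=.
  rewrite (dualW0 _ (zeros_box N K)) eqxx mulr1 big1_seq ?addr0; last first.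
    move=> nu /andP[/negbTE nu0 nub].
    by rewrite (dualW0 _ nub) nu0 mulr0.
  have smu : size mu = N by move: mub; rewrite mem_box => /andP[/eqP].
  rewrite /hl_op !hlker_zeros // mulr0 addr0 (dualW0 _ mub) /=; congr (_%:R).
  congr nat_of_bool; apply/idP/eqP => [/(all_zeros mub)//|->].
  by rewrite all_nseq eqxx orbT.
pose x' r := x (widen_ord (leqnSn n) r).
have nN' : (n < N)%N by exact: ltnW.
(* T_u raises entries to at most M + 1 and S_x then doubles them, which gives [K1]; the strict
   bounds in the commutation need one more. *)
pose K1 := M.+1.*2; pose K2 := K1.+1.
have [smu muM] : size mu = N /\ all (leq^~ M) mu.
  by move: mub; rewrite mem_box => /andP[/eqP].
have MK2 : (M.+1 <= K2)%N by rewrite /K2 /K1; clear; lia.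
transitivity (\sum_(nu <- box N M.+1) \sum_(la <- box N K1)
   hl_op q s u mu nu * (qhahn_op q s (x ord_max) K2 nu la * dualW x' la)).
  rewrite -(@box_widen _ N M.+1 K) //; last first.
    move=> nu nub; rewrite mulf_eq0 => /norP[+ _]; exact: (hl_op_box mub nub).
  apply: eq_big_seq => nu nub; rewrite -mulr_sumr; congr (_ * _).
  rewrite (dualWS _ nub); apply: eq_bigr => la _; congr (_ * _).
  apply: qhahn_op_widen; first exact: leqnSn.
  move: nub; rewrite mem_box => /andP[_]; apply: sub_all => i /=.
  by clear; lia.
rewrite exchange_big /=.
transitivity (\sum_(la <- box N K1) (1 + u * x ord_max) / (1 - s * u) *
   (\sum_(ka <- box N K2) qhahn_op q s (x ord_max) K2 mu ka * hl_op q s u ka la)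
   * dualW x' la).
  (* Only states with nonzero [dualW x' la] matter, and their last column is empty. *)
  apply: eq_big_seq => la lab; have [->|la0] := eqVneq (dualW x' la) 0.
    by rewrite mulr0 big1 // => nu _; rewrite !mulr0.
  have [sla laM] : size la = N /\ all (leq^~ K1) la.
    by move: lab; rewrite mem_box => /andP[/eqP].
  under eq_bigr do rewrite mulrA.
  rewrite -mulr_suml; congr (_ * _).
  rewrite (box_widen MK2); last first.
    by move=> nu nub; rewrite mulf_eq0 => /norP[+ _]; exact: (hl_op_box mub nub).
  rewrite -{1 2}smu; apply: hl_qhahn_op_comm; rewrite ?smu ?sla //.
  - by apply: sub_all muM => i /= iM; apply: leq_trans MK2.
  - move: la0; rewrite /dualW mulf_eq0 => /norP[_ /sqW_to_supp h].
    case: (lastP la) sla h => [/=|la' l]; first by move: nN; case: (N).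
    rewrite size_rcons last_rcons => sla h; have := h (size la').
    rewrite nth_rcons ltnn eqxx; apply.
    by move: sla nN; clear; lia.
under [LHS]eq_bigr do rewrite mulr_sumr mulr_suml.
rewrite exchange_big /= big_ord_recr /=.
transitivity (\sum_(ka <- box N K2) (1 + u * x ord_max) / (1 - s * u) *
   (qhahn_op q s (x ord_max) K2 mu ka * (\prod_(j < n) ((1 + u * x' j) / (1 - s * u)) *
   dualW x' ka))).
  (* Where the S_x entry is nonzero, [ka] is bounded by 2M < [K1], so the induction hypothesis
     applies. *)
  apply: eq_big_seq => ka kab.
  have [ka0|ka0] := eqVneq (qhahn_op q s (x ord_max) K2 mu ka) 0.
    by rewrite ka0 mul0r mulr0 big1 // => la _; rewrite !(mul0r, mulr0).
  have MK1 : (M.*2 < K1)%N by rewrite /K1 doubleS; clear; lia.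
  rewrite -(IH x' _ _ _ nN' (qhahn_op_box mub kab ka0) MK1).
  rewrite !mulr_sumr; apply: eq_bigr => la _; ring.
rewrite (dualWS _ mub) !mulr_sumr.
rewrite (@box_widen _ N M.*2 K2); first last.
- move=> ka kab; rewrite !mulf_eq0 => /norP[_ /norP[+ _]]; exact: (qhahn_op_box mub kab).
- by rewrite /K2 /K1; clear; lia.
apply: eq_bigr => ka _; rewrite -/x' -(@qhahn_op_widen _ _ _ _ M.*2 K2).
- ring.
- by rewrite /K2 /K1; clear; lia.
- by apply: sub_all muM => i /=; clear; lia.
Qed.

Lemma dualW_zeros n (x : 'I_n -> C) N : dualW x (nseq N 0%N) = 1.
Proof.
elim: n x => [|n IH] x; first by rewrite (dualW0 _ (zeros_box N 0)) eqxx.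
rewrite (dualWS _ (zeros_box N 0)).
rewrite [0.*2]/= box0 big_seq1 IH mulr1 /qhahn_op /=
  big_seq1 /left_boundary xpoch0 qpoch0 divr1 mul1r.
by elim: (N) => //= N' ->; rewrite qhahn00 mul1r.
Qed.

End Eigenfunction.

(** * Partitions and multiplicities *)

Lemma intpart_geq (la : intpart) : sorted geq la.
Proof. by case: la => l /= /andP[]. Qed.

Lemma intpart_notin0 (la : intpart) : 0%N \notin parts la.
Proof. by case: la => l /= /andP[]. Qed.

Lemma geq_trans : transitive geq.
Proof. by move=> a b c /= ba ac; exact: leq_trans ac ba. Qed.

Lemma eq_intpart (la mu : intpart) :
  (forall c, mult la c.+1 = mult mu c.+1) -> la = mu.
Proof.
move=> h; apply/val_inj/(sorted_eq geq_trans).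
- by move=> a b /= /andP[? ?]; apply/eqP; rewrite eqn_leq; apply/andP.
- exact: intpart_geq.
- exact: intpart_geq.
apply/allP => -[|c] _ /=; last by rewrite [count_mem _ _]h.
by rewrite !(count_memPn _) ?intpart_notin0.
Qed.

Lemma part_conj (la : intpart) c : part (conj_part la) c = count (ltn c) la.
Proof.
rewrite /part /= /conj_seq; have [ch|ch] := ltnP c (head 0%N la).
  by rewrite nth_mkseq.
rewrite nth_default ?size_mkseq //; apply/esym/eqP.
rewrite -leqn0 leqNgt -has_count; apply/hasPn => a ala /=.
rewrite -leqNgt; apply: leq_trans ch.
case: la (intpart_geq la) ala => -[//|b l] p /= sl.
rewrite inE => /predU1P[->//|al].
by have /allP/(_ _ al) := order_path_min geq_trans sl.
Qed.

Lemma mult_part_conj (la : intpart) c :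
  (part (conj_part la) c - part (conj_part la) c.+1)%N = mult la c.+1.
Proof.
rewrite !part_conj /mult.
have -> : count (ltn c) la = (count_mem c.+1 la + count (ltn c.+1) la)%N.
  rewrite -count_predUI.
  rewrite [X in (_ + X)%N](_ : _ = 0%N) ?addn0; last first.
    rewrite -(count_pred0 la); apply: eq_count => a /=.
    by case: eqP => // ->; rewrite ltnn.
  by apply: eq_count => a /=; rewrite [LHS]leq_eqVlt eq_sym.
by rewrite addnK.
Qed.

(** The parts larger than [i] form an initial segment. This is the symmetry of the Young diagram
    behind [conj_partK]. *)
Lemma count_gt_sorted (la : intpart) i c :
  (c < count (ltn i) la)%N = (i < part la c)%N.
Proof.
rewrite /part; move: (intpart_geq la); elim: (parts la) c => [|a l IH] c /=.
  by rewrite nth_nil !ltn0.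
move=> sl; have sl' := path_sorted sl; have al := order_path_min geq_trans sl.
have [ia|ai] := ltnP i a.
  by case: c => [|c] /=; rewrite ?ia // add1n ltnS IH.
rewrite add0n IH //.
have nai j : (nth 0%N l j <= i)%N.
  have [jl|jl] := ltnP j (size l); last by rewrite nth_default.
  by move/allP: al => /(_ _ (mem_nth 0%N jl)) /= h; exact: leq_trans ai.
rewrite ltnNge nai /=; case: c => [|c] /=; rewrite ltnNge ?ai //=.
by rewrite nai.
Qed.

Lemma conj_partK (la : intpart) : conj_part (conj_part la) = la.
Proof.
have pe c : part (conj_part (conj_part la)) c = part la c.
  rewrite part_conj /= /conj_seq /mkseq count_map.
  rewrite (eq_count (a2 := fun i => (i < part la c)%N)); last first.
    by move=> i /=; rewrite count_gt_sorted.
  have hp : (part la c <= head 0%N la)%N.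
    rewrite /part; have [cl|cl] := ltnP c (size la); last by rewrite nth_default.
    case: la (intpart_geq la) cl => -[//|a l] p /= sl.
    case: c => //= c; rewrite ltnS => cl.
    by have /allP/(_ _ (mem_nth 0%N cl)) := order_path_min geq_trans sl.
  rewrite -(subnKC hp) iotaD count_cat add0n.
  rewrite [X in (_ + X)%N](_ : _ = 0%N) ?addn0; last first.
    apply/eqP; rewrite -leqn0 leqNgt -has_count; apply/hasPn => i.
    by rewrite mem_iota -leqNgt => /andP[].
  apply/eqP; rewrite -[X in _ == X](size_iota 0) -all_count; apply/allP => i.
  by rewrite mem_iota.
apply/val_inj; apply: (@eq_from_nth _ 0%N); last by move=> i _; exact: pe.
(* [part] cannot see the length, its default being 0; the lengths agree because the parts of [la]
   are positive. *)
rewrite /= /conj_seq size_mkseq.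
have -> : head 0%N (mkseq (fun i => count (fun a => (i < a)%N) la) (head 0%N la)) =
    part (conj_part la) 0 by rewrite /part nth0.
rewrite part_conj; apply/eqP; rewrite -all_count; apply/allP => a ala /=.
by rewrite lt0n; apply: contra (intpart_notin0 la) => /eqP <-.
Qed.

(** * Partitions encoded by vectors of multiplicities *)

Definition mults N (la : intpart) : seq nat := mkseq (fun c => mult la c.+1) N.

Lemma of_mults_subproof (v : seq nat) :
  is_intpart (sort geq (flatten (mkseq (fun c => nseq (nth 0%N v c) c.+1) (size v)))).
Proof.
rewrite /is_intpart sort_sorted; last by move=> a b; exact: leq_total.
rewrite mem_sort; apply/flattenP => -[_ /mapP[c _ ->]].
by rewrite mem_nseq => /andP[].
Qed.

Definition of_mults (v : seq nat) : intpart := IntPart (of_mults_subproof v).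

Lemma mult_of_mults v c : mult (of_mults v) c.+1 = nth 0%N v c.
Proof.
rewrite /mult /= count_sort count_flatten -map_comp sumnE big_map.
rewrite iota_index big_mkord.
under eq_bigr do rewrite /= count_nseq /= eqSS.
have [cv|cv] := ltnP c (size v).
  rewrite (bigD1 (Ordinal cv)) //= eqxx mul1n big1 ?addn0 // => i ic.
  by case: eqP => // e; case/eqP: ic; exact/ord_inj.
rewrite nth_default // big1 // => i _.
by case: eqP => // e; move: (ltn_ord i); rewrite e ltnNge cv.
Qed.

Lemma mults_of_mults N v : size v = N -> mults N (of_mults v) = v.
Proof.
move=> sv; apply: (@eq_from_nth _ 0%N); first by rewrite size_mkseq.
by rewrite size_mkseq => i iN; rewrite nth_mkseq // mult_of_mults.
Qed.

(** All parts are at most [N]; equivalently, the conjugate has at most [N] parts. *)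
Definition columns_le N (la : intpart) := forall c, (N <= c)%N -> mult la c.+1 = 0%N.

Lemma nth_mults N la c : columns_le N la -> nth 0%N (mults N la) c = mult la c.+1.
Proof. by move=> laN; rewrite nth_mkseq0. Qed.

Lemma of_multsK N la : columns_le N la -> of_mults (mults N la) = la.
Proof. by move=> laN; apply: eq_intpart => c; rewrite mult_of_mults nth_mults. Qed.

Lemma columns_of_mults N v : size v = N -> columns_le N (of_mults v).
Proof. by move=> <- c vc; rewrite mult_of_mults nth_default. Qed.

Definition intparts_box N K : seq intpart := [seq of_mults v | v <- box N K].

Lemma intparts_box_uniq N K : uniq (intparts_box N K).
Proof.
rewrite map_inj_in_uniq ?box_uniq // => v w.
rewrite !mem_box => /andP[/eqP sv _] /andP[/eqP sw _] vw.
by rewrite -(mults_of_mults sv) vw mults_of_mults.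
Qed.

Lemma mem_intparts_box N K la : columns_le N la ->
  (forall c, (mult la c.+1 <= K)%N) -> la \in intparts_box N K.
Proof.
move=> laN laK; apply/mapP; exists (mults N la); last by rewrite of_multsK.
exact: mkseq_box.
Qed.

Lemma of_mults_zeros N : of_mults (nseq N 0%N) = empty_intpart.
Proof. by apply: eq_intpart => c; rewrite mult_of_mults nth_nseq if_same. Qed.

Lemma ctilde_mults (C : numFieldType) (q s : C) N la : columns_le N la ->
  ctilde q s la = ctilde_seq q s (mults N la).
Proof.
move=> laN; rewrite /ctilde (iprod_finite (N := N)); last first.
  by move=> c Nc; rewrite laN // !qpoch0 divr1.
rewrite /ctilde_seq big_map iota_index big_mkord.
by [].
Qed.

(** * Stable spin Hall-Littlewood functions *)

Section StableHallLittlewood.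
Variables (C : numFieldType) (q s : C).

(** Far to the right [h] is 0. Where [la] is empty, a label 0 leaving a column forces a label 0
    entering it, so the vanishing spreads leftwards to column [N]. *)
Lemma columns_descend N (mu la : nat -> nat) (h : nat -> bool) :
  (\forall c \near \oo, h c = false) ->
  (forall c, mu c + h c = la c + h c.+1)%N ->
  (forall c, (N <= c)%N -> la c = 0%N) ->
  forall c, (N <= c)%N -> mu c = 0%N /\ h c = false.
Proof.
move=> [c0 _ h0] e la0.
(* Induction on the distance to the threshold [c0]. *)
have hF d : forall c, (N <= c)%N -> (c0 <= c + d)%N -> h c = false.
  elim: d => [|d IH] c Nc cd; first by apply: h0 => /=; rewrite -(addn0 c).
  have := e c; rewrite la0 // (IH c.+1) ?(leqW Nc) ?addSnnS //.
  by case: (h c) => //=; rewrite addn1.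
move=> c Nc; have hc : h c = false by apply: (hF c0) => //; rewrite leq_addl.
split=> //; have := e c; rewrite hc la0 // (hF c0 c.+1) ?(leqW Nc) ?leq_addl //.
by rewrite !addn0.
Qed.

Lemma opC_neq0 u mu la : opC q s u mu la != 0 ->
  exists2 h : nat -> bool, (\forall c \near \oo, h c = false) &
    forall c, (mult mu c.+1 + h c = mult la c.+1 + h c.+1)%N.
Proof.
move=> /fsbig_neq0[h h0]; rewrite mulf_eq0 => /norP[_ /iprod_neq0 w].
by exists h => // c; exact: weightw_neq0 (w c).
Qed.

Lemma opC_columns u N mu la : opC q s u mu la != 0 -> columns_le N la ->
  columns_le N mu.
Proof.
move=> /opC_neq0[h h0 e] laN c Nc.
by have [] := columns_descend h0 e laN Nc.
Qed.

Lemma opC_mult u mu la c : opC q s u mu la != 0 ->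
  (mult la c.+1 <= (mult mu c.+1).+1)%N.
Proof.
move=> /opC_neq0[h _ /(_ c)]; case: (h c); case: (h c.+1); clear; lia.
Qed.

(** Sequences of nonzero weight vanish from [N] on by [columns_descend], and an empty column has
    weight 1 because su differs from 1; so both the sum and the product can be cut at [N]. *)
Lemma opC_hl_op u N mu la : 1 - s * u != 0 -> columns_le N mu -> columns_le N la ->
  opC q s u mu la = hl_op q s u (mults N mu) (mults N la).
Proof.
move=> hu muN laN.
pose r := [seq nth false h | h <- words [:: false; true] N].
have mem01 (b : bool) : b \in [:: false; true] by case: b.
rewrite /opC (@fsbig_seq_supp _ _ _ r).
- rewrite big_map.
  transitivity (\sum_(j <- [:: false; true]) u ^+ j *
      hlker q s u j (mults N mu) (mults N la)); last first.
    by rewrite big_cons big_seq1 /= expr0 expr1 mul1r.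
  rewrite /hlker -(@rowker_sum _ _ _ _ _ N) ?size_mkseq //.
  apply: eq_big_seq => h; rewrite mem_words => /andP[/eqP sh _].
  congr (_ * _); rewrite (iprod_finite (N := N)) => [|c Nc].
    by apply: eq_bigr => c _; rewrite !nth_mults.
  rewrite muN // laN // !nth_default ?sh // ?leqW //.
  by rewrite /weightw /= expr0 mulr1 divff.
- rewrite map_inj_in_uniq ?words_uniq // => h h'.
  rewrite !mem_words => /andP[/eqP sh _] /andP[/eqP sh' _] hh.
  by apply: (@eq_from_nth _ false); rewrite ?sh ?sh' // => i _; rewrite hh.
- move=> _ /mapP[h _ ->]; exists (size h) => // c /= hc.
  by rewrite nth_default.
move=> h h0; rewrite mulf_eq0 => /norP[_ /iprod_neq0 w].
have e c : (mult mu c.+1 + h c = mult la c.+1 + h c.+1)%N.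
  exact: weightw_neq0 (w c).
apply/mapP; exists (mkseq h N).
  rewrite mem_words size_mkseq eqxx; apply/allP => b _; exact: mem01.
apply/funext => c; have [cN|cN] := ltnP c N; first by rewrite nth_mkseq.
rewrite nth_default ?size_mkseq //.
by have [] := columns_descend h0 e laN cN.
Qed.

(** * Chains of partitions and their branching rule *)

Definition chain_weight m (u : 'I_m -> C) (nu : 'I_m.+1 -> intpart) : C :=
  \prod_(r < m) opC q s (u r) (nu (widen_ord (leqnSn m) r)) (nu (lift ord0 r)).

Definition chain_ext m (nu : 'I_m.+1 -> intpart) la : 'I_m.+2 -> intpart :=
  fun r => if unlift ord_max r is Some r' then nu r' else la.

Lemma chain_extK m (nu : 'I_m.+1 -> intpart) la :
  (fun r => chain_ext nu la (widen_ord (leqnSn m.+1) r)) = nu.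
Proof. by apply/funext => r; rewrite /chain_ext unlift_widen. Qed.

Lemma chain_ext_max m (nu : 'I_m.+1 -> intpart) la : chain_ext nu la ord_max = la.
Proof. by rewrite /chain_ext unlift_none. Qed.

Lemma chain_restrK m (nu : 'I_m.+2 -> intpart) :
  chain_ext (fun r => nu (widen_ord (leqnSn m.+1) r)) (nu ord_max) = nu.
Proof.
apply/funext => r; rewrite /chain_ext.
by case: unliftP => [r' ->|->] //; rewrite widen_lift_max.
Qed.

Lemma chain_weight_recr m (u : 'I_m.+1 -> C) (nu : 'I_m.+2 -> intpart) :
  chain_weight u nu =
  chain_weight (fun r => u (widen_ord (leqnSn m) r))
    (fun r => nu (widen_ord (leqnSn m.+1) r)) *
  opC q s (u ord_max) (nu (widen_ord (leqnSn m.+1) ord_max)) (nu ord_max).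
Proof.
rewrite /chain_weight big_ord_recr /=.
have -> : lift ord0 (@ord_max m) = ord_max :> 'I_m.+2 by apply/ord_inj.
congr (_ * _); apply: eq_bigr => r _.
have -> : lift ord0 (widen_ord (leqnSn m) r) =
  widen_ord (leqnSn m.+1) (lift ord0 r) by apply/ord_inj.
by [].
Qed.

Lemma chain_weight_ext m (u : 'I_m.+1 -> C) (nu : 'I_m.+1 -> intpart) la :
  chain_weight u (chain_ext nu la) =
  chain_weight (fun r => u (widen_ord (leqnSn m) r)) nu *
  opC q s (u ord_max) (nu ord_max) la.
Proof.
rewrite chain_weight_recr chain_extK chain_ext_max.
by rewrite /chain_ext unlift_widen.
Qed.

Lemma ord0_widen m : ord0 = widen_ord (leqnSn m.+1) ord0 :> 'I_m.+2.
Proof. exact/ord_inj. Qed.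

(** Each step raises a multiplicity by at most one, starting from the empty partition. *)
Lemma chain_mult m (u : 'I_m -> C) nu c : nu ord0 = empty_intpart ->
  chain_weight u nu != 0 -> (mult (nu ord_max) c.+1 <= m)%N.
Proof.
elim: m u nu => [|m IH] u nu nu0.
  by have -> : ord_max = ord0 :> 'I_1 by [exact/ord_inj]; rewrite nu0.
rewrite chain_weight_recr mulf_eq0 => /norP[w /(opC_mult c) h].
apply: leq_trans h _; rewrite ltnS; apply: (IH _ _ _ w).
by rewrite -ord0_widen.
Qed.

Lemma sHL_mult m (u : 'I_m -> C) la c : sHL q s u la != 0 ->
  (mult la c.+1 <= m)%N.
Proof. by move=> /fsbig_neq0[nu [nu0 <-]]; exact: chain_mult. Qed.

(** After m' steps all multiplicities are at most m', and the bound [N] on the columns of [la]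
    passes down the chain by [opC_columns]; so these boxes contain every chain of nonzero weight. *)
Fixpoint chains (N m : nat) (la : intpart) : seq ('I_m.+1 -> intpart) :=
  match m with
  | 0 => if la == empty_intpart then [:: fun=> la] else [::]
  | m'.+1 => [seq chain_ext nu la | mu <- intparts_box N m', nu <- chains N m' mu]
  end.

Lemma chains_ends N m la nu : nu \in chains N m la ->
  nu ord0 = empty_intpart /\ nu ord_max = la.
Proof.
elim: m la nu => [|m IH] la nu /=.
  by case: eqP => // ->; rewrite mem_seq1 => /eqP ->.
move=> /allpairsPdep[mu [nu' [_ /IH[h1 _] ->]]]; rewrite chain_ext_max; split=> //.
by rewrite ord0_widen /chain_ext unlift_widen.
Qed.

Lemma chains_uniq N m la : uniq (chains N m la).
Proof.
elim: m la => [|m IH] la /=; first by case: ifP.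
apply: allpairs_uniq_dep; rewrite ?intparts_box_uniq //.
move=> [p nu] [p' nu'].
move=> /allpairsPdep[p1 [nu1 [_ nu1p [e1 e2]]]].
move=> /allpairsPdep[p2 [nu2 [_ nu2p [e3 e4]]]].
subst p nu p' nu'; rewrite /= => e.
have enu : nu1 = nu2 by rewrite -(chain_extK nu1 la) e chain_extK.
subst nu2; have [_ m1] := chains_ends nu1p; have [_ m2] := chains_ends nu2p.
by rewrite -m1 m2.
Qed.

Lemma chains_supp N m (u : 'I_m -> C) la nu : columns_le N la ->
  nu ord0 = empty_intpart -> nu ord_max = la -> chain_weight u nu != 0 ->
  nu \in chains N m la.
Proof.
elim: m u la nu => [|m IH] u la nu laN nu0 num.
  have -> : nu = fun=> la.
    by apply/funext => r; rewrite -num; congr nu; rewrite !ord1.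
  move=> _ /=; rewrite ifT ?inE ?eqxx // -num -nu0; apply/eqP; congr nu.
  exact/ord_inj.
rewrite chain_weight_recr mulf_eq0 => /norP[w1 w2].
pose nu' r := nu (widen_ord (leqnSn m.+1) r).
have nu'0 : nu' ord0 = empty_intpart by rewrite /nu' -ord0_widen.
have nu'N : columns_le N (nu' ord_max) by apply: opC_columns w2 _; rewrite num.
apply/allpairsPdep; exists (nu' ord_max), nu'; split.
- by apply: mem_intparts_box => // c; exact: chain_mult w1.
- exact: IH w1.
- by rewrite -num chain_restrK.
Qed.

Lemma sHLE N m (u : 'I_m -> C) la : columns_le N la ->
  sHL q s u la = \sum_(nu <- chains N m la) chain_weight u nu.
Proof.
move=> laN; apply: fsbig_seq_supp; first exact: chains_uniq.
  by move=> nu; exact: chains_ends.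
by move=> nu [nu0 num]; exact: chains_supp.
Qed.

Lemma sHL0 (u : 'I_0 -> C) : sHL q s u empty_intpart = 1.
Proof.
by rewrite (@sHLE 0) // big_seq1 /chain_weight big_ord0.
Qed.

Lemma sHLS N m (u : 'I_m.+1 -> C) la : columns_le N la ->
  sHL q s u la = \sum_(mu <- intparts_box N m)
    sHL q s (fun r => u (widen_ord (leqnSn m) r)) mu * opC q s (u ord_max) mu la.
Proof.
move=> laN; rewrite (sHLE _ laN) /= big_allpairs_dep /=.
apply: eq_big_seq => mu /mapP[v]; rewrite mem_box => /andP[/eqP sv _] ev.
have muN : columns_le N mu by rewrite ev; exact: columns_of_mults.
rewrite (sHLE _ muN) mulr_suml; apply: eq_big_seq => nu nuc.
by rewrite chain_weight_ext; have [_ ->] := chains_ends nuc.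
Qed.

(** * The Cauchy sum *)

Hypothesis hq : forall k, 1 - q ^+ k.+1 != 0.
Hypothesis hs : forall k, 1 - s ^+ 2 * q ^+ k != 0.

(** Induction on m: the last operator T_u acts on its eigenfunction [dualW] and splits off a scalar.
    With n variables, [n.+1] columns satisfy the condition of [dualW_eigen]. *)
Lemma sum_sHL_dualW m n (u : 'I_m -> C) (x : 'I_n -> C) :
  (forall i, 1 - s * u i != 0) ->
  \sum_(la <- intparts_box n.+1 m) sHL q s u la * dualW q s x (mults n.+1 la) =
  \prod_(i < m) \prod_(j < n) ((1 + u i * x j) / (1 - s * u i)).
Proof.
elim: m u => [|m IH] u hu.
  have -> : intparts_box n.+1 0 = [:: empty_intpart].
    by rewrite -(of_mults_zeros n.+1) /intparts_box box0.
  rewrite big_seq1 sHL0 big_ord0 mul1r -(of_mults_zeros n.+1) mults_of_mults.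
    exact: dualW_zeros.
  exact: size_nseq.
rewrite big_ord_recr /= -IH // mulr_suml.
transitivity (\sum_(la <- intparts_box n.+1 m.+1) \sum_(mu <- intparts_box n.+1 m)
    sHL q s (fun r => u (widen_ord (leqnSn m) r)) mu *
    (opC q s (u ord_max) mu la * dualW q s x (mults n.+1 la))).
  apply: eq_big_seq => la /mapP[v]; rewrite mem_box => /andP[/eqP sv _] ev.
  rewrite (@sHLS n.+1) ?mulr_suml; last by rewrite ev; exact: columns_of_mults.
  by apply: eq_bigr => mu _; rewrite mulrA.
rewrite exchange_big /=; apply: eq_big_seq => mu /mapP[w wb ->].
rewrite -mulr_sumr -mulrA; congr (_ * _); rewrite big_map.
have sw : size w = n.+1 by move: wb; rewrite mem_box => /andP[/eqP].
rewrite mults_of_mults // mulrC -(dualW_eigen hq hs x (hu _) (ltnSn n) wb (ltnSn m)).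
apply: eq_big_seq => v; rewrite mem_box => /andP[/eqP sv _].
by rewrite (@opC_hl_op _ n.+1) ?mults_of_mults //; exact: columns_of_mults.
Qed.

Lemma sqW_conj n (x : 'I_n -> C) la :
  sqW q s x (conj_part la) = sqW_to q s x (fun c => mult la c.+1).
Proof.
rewrite sqWE; congr sqW_to; apply/funext => c; exact: mult_part_conj.
Qed.

Lemma sqW_columns n (x : 'I_n -> C) la : sqW q s x (conj_part la) != 0 ->
  columns_le n.+1 la.
Proof.
by rewrite sqW_conj => /sqW_to_supp h c nc; apply: h; exact: ltnW.
Qed.

Lemma dualWE n (x : 'I_n -> C) N la : columns_le N la ->
  dualW q s x (mults N la) = ctilde q s la * sqW q s x (conj_part la).
Proof.
move=> laN; rewrite /dualW (ctilde_mults _ _ laN) sqW_conj nth_mkseq0 //.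
Qed.

End StableHallLittlewood.

Local Open Scope complex_scope.

(** The finiteness claims give the sums their meaning: a finitely supported sum is 0 by convention
    when its support is infinite. *)
Theorem corollary7p4 (R : realType) (q s : R[i])
    (hq : `|q| < 1) (hs : `|s| < 1)
    (m n : nat) (hm : (0 < m)%N) (hn : (0 < n)%N)
    (u : 'I_m -> R[i]) (x : 'I_n -> R[i]) (hu : forall i, s * u i != 1) :
  [/\ finite_set [set la : intpart |
        sHL q s u la * sqW_dual q s x (conj_part la) != 0],
      finite_set [set la : intpart |
        sHL_dual q s u la * sqW q s x (conj_part la) != 0],
      \sum_(la \in [set: intpart]) sHL q s u la * sqW_dual q s x (conj_part la) =
      \sum_(la \in [set: intpart]) sHL_dual q s u la * sqW q s x (conj_part la) &
      \sum_(la \in [set: intpart]) sHL_dual q s u la * sqW q s x (conj_part la) =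
      \prod_(i < m) \prod_(j < n) ((1 + u i * x j) / (1 - s * u i))].
Proof.
have hq' k : 1 - q ^+ k.+1 != 0.
  rewrite subr_eq0; apply/eqP => e.
  have : `|q ^+ k.+1| < 1 by rewrite normrX exprn_ilt1 // normr_ge0.
  by rewrite -e normr1 ltxx.
have hs' k : 1 - s ^+ 2 * q ^+ k != 0.
  rewrite subr_eq0; apply/eqP => e.
  have : `|s ^+ 2 * q ^+ k| < 1.
    rewrite normrM !normrX; apply: (@le_lt_trans _ _ (`|s| ^+ 2)).
      by rewrite ler_piMr ?exprn_ge0 ?exprn_ile1 ?normr_ge0 // ltW.
    by rewrite exprn_ilt1 // normr_ge0.
  by rewrite -e normr1 ltxx.
have hu' i : 1 - s * u i != 0 by rewrite subr_eq0 eq_sym.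
have dual la : sHL q s u la * sqW_dual q s x (conj_part la) =
    sHL_dual q s u la * sqW q s x (conj_part la).
  by rewrite /sqW_dual /sHL_dual conj_partK mulrCA mulrA.
(* The polynomial bounds the columns through the number of variables x, and the Hall-Littlewood
   function bounds the multiplicities by m. *)
have supp la : sHL_dual q s u la * sqW q s x (conj_part la) != 0 ->
    la \in intparts_box n.+1 m.
  rewrite /sHL_dual !mulf_eq0 => /norP[/norP[_ h1] h2].
  apply: mem_intparts_box; first exact: sqW_columns h2.
  by move=> c; exact: sHL_mult h1.
have fin : finite_set [set la : intpart |
    sHL_dual q s u la * sqW q s x (conj_part la) != 0].
  by apply: sub_finite_set (finite_seq (intparts_box n.+1 m)) => la; exact: supp.
split => //.
- by under eq_set do rewrite dual.
- by apply: eq_fsbigr => la _; exact: dual.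
rewrite (@fsbig_seq_supp _ _ _ (intparts_box n.+1 m)) ?intparts_box_uniq //;
  last by move=> la _; exact: supp.
rewrite -(sum_sHL_dualW hq' hs' x hu'); apply: eq_big_seq => la /mapP[v].
rewrite mem_box => /andP[/eqP sv _] ->.
rewrite dualWE; last exact: columns_of_mults.
by rewrite /sHL_dual mulrCA mulrA.
Qed.
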